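(* Let $A\in\mathbb{R}^{m\times n}$ ($m<n$) and $M\in\mathbb{R}^{m\times q}$ ($m\le q$) with $\mathrm{rank}(A)=\mathrm{rank}(M)=m$, let $y\in\mathbb{R}^m$ and $\tau>0$ be given, and let $\phi$ be a norm on $\mathbb{R}^q$ with $\phi(\mathbf e_i)=\phi^*(\mathbf e_i)=1$ for $i=1,\dots,q$. Consider the problem $$(\mathrm{P})\qquad\min_x\{\|x\|_1:\ \phi(M^T(Ax-y))\le\tau\}.$$ Let $\delta\in(0,\tau)$ be a fixed constant and let $\mathcal Q_{\epsilon_{j_0}}$ be a fixed polytope from the family $\{\mathcal Q_{\epsilon_j}\}$ defined in the context such that $d^{\mathcal H}(S^*,S_{\epsilon_{j_0}})\le\delta$. Suppose that one of the following conditions holds: (a) $A$ (with $\ell_2$-normalized columns) satisfies the mutual coherence property $\mu_1(k)+\mu_1(k-1)<1$; (b) RIP of order $2k$ with constant $\delta_{2k}<1/\sqrt2$; (c) stable NSP of order $k$ with constant $\rho\in(0,1)$; (d) robust NSP of order $k$ with constants $\rho'\in(0,1)$ and $\rho''>0$; (e) NSP of order $k$; (f) RSP of order $k$ of $A^T$. Then for any $x\in\mathbb{R}^n$ there is an optimal solution $x^*$ of $(\mathrm{P})$ with $$\|x-x^*\|_2\le\delta+2\overline\gamma\left\{\widehat n\left(\phi(M^T(Ax-y))-\tau\right)^++2\sigma_k(x)_1+c\tau+c\,\phi(M^T(Ax-y))\right\},$$ where $\widehat n$ is the number of columns of $\Gamma_{\mathcal Q_{\epsilon_{j_0}}}$,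 $$c=\max_{G\subseteq\{1,\dots,q\},\,|G|=m}\{\|M_G^{-1}(AA^T)^{-1}A\|_{\infty\to1}:\ M_G\in\mathbb{R}^{m\times m}\text{ is an invertible submatrix of }M\},$$ and $\overline\gamma=\sigma_{\infty,2}(\overline M^1,\overline M^2)$ is the Robinson's constant of the pair $(\overline M^1,\overline M^2)$ defined in the context. Moreover, for any $x$ satisfying the constraint of $(\mathrm{P})$ there is an optimal solution $x^*$ of $(\mathrm{P})$ with $$\|x-x^*\|_2\le\delta+2\overline\gamma\{2\sigma_k(x)_1+c\tau+c\,\phi(M^T(Ax-y))\}\le\delta+4\overline\gamma\{\sigma_k(x)_1+c\tau\}.$$
   Context: Notation: $\mathbf e_i$ are the standard basis vectors of $\mathbb{R}^q$; $\phi^*(u)=\max_{\phi(x)\le1}u^Tx$ is the dual norm; $(s)^+=\max\{s,0\}$; $\sigma_k(x)_1=\inf_u\{\|x-u\|_1:\|u\|_0\le k\}$, where $\|u\|_0$ is the number of nonzero entries; $M_G$ is the submatrix of $M$ consisting of columns indexed by $G$; $\|Q\|_{\infty\to1}=\max_{\|x\|_\infty\le1}\|Qx\|_1$; for $S\subseteq\{1,\dots,n\}$, $\overline S$ is its complement and $\zeta_S$ the subvector of $\zeta$ indexed by $S$; $d^{\mathcal H}(\Omega_1,\Omega_2)=\max\{\sup_{u\in\Omega_1}\inf_{z\in\Omega_2}\|u-z\|_2,\ \sup_{z\in\Omega_2}\inf_{u\in\Omega_1}\|u-z\|_2\}$ is the Hausdorff distance. Matrix conditions. Mutual coherence: for $A$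 with $\ell_2$-normalized columns $a_1,\dots,a_n$, $\mu_1(k)=\max_{i}\max\{\sum_{j\in S}|a_i^Ta_j|:\ S\subseteq\{1,\dots,n\},\ |S|=k,\ i\notin S\}$ (with $1\le k\le n-1$, and $\mu_1(0)=0$). RIP of order $k$ with constant $\delta_k\in(0,1)$: $(1-\delta_k)\|x\|_2^2\le\|Ax\|_2^2\le(1+\delta_k)\|x\|_2^2$ for all $k$-sparse $x$ (at most $k$ nonzero entries). NSP of order $k$: $\|\zeta_S\|_1<\|\zeta_{\overline S}\|_1$ for all $\zeta\ne0$ with $A\zeta=0$ and all $|S|\le k$. Stable NSP of order $k$ with constant $\rho\in(0,1)$: $\|\zeta_S\|_1\le\rho\|\zeta_{\overline S}\|_1$ for all $\zeta\neq 0$ with $A\zeta=0$ and all $|S|\le k$. Robust NSP of order $k$ with constants $\rho'\in(0,1)$, $\rho''>0$: $\|\zeta_S\|_1\le\rho'\|\zeta_{\overline S}\|_1+\rho''\|A\zeta\|$ for all $\zeta\in\mathbb{R}^n$ and all $|S|\le k$, where $\|\cdot\|$ is a norm on $\mathbb{R}^m$. RSP of order $k$ of $A^T$: for any disjoint $S_1,S_2\subseteq\{1,\dots,n\}$ with $|S_1|+|S_2|\le k$ there exists $\zeta\in\mathcal{R}(A^T)$ (the range of $A^T$) with $\zeta_i=1$ for $i\in S_1$, $\zeta_i=-1$ for $i\in S_2$, and $|\zeta_i|<1$ for $i\notin S_1\cup S_2$. Polytopes $\mathcal Q_{\epsilon_j}$: let $\mathfrak B^\phi=\{x\in\mathbb{R}^q:\phi(x)\le1\}$.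 Fix $\chi>e/(4\sqrt2)$. By a theorem of Barvinok there is $\epsilon_0=\epsilon_0(\chi)>0$ such that for each $0<\epsilon<\epsilon_0$ there is a symmetric polytope $P_\epsilon\subset\mathbb{R}^q$ with at most $\left(\frac{\chi}{\sqrt\epsilon}\ln\frac1\epsilon\right)^q$ vertices and $P_\epsilon\subseteq\mathfrak B^\phi\subseteq(1+\epsilon)P_\epsilon$; fix such $P_\epsilon$. Shifting each facet hyperplane of $(1+\epsilon)P_\epsilon$ in parallel toward $\mathfrak B^\phi$ until it touches $\mathfrak B^\phi$ gives a polytope $\widehat P_\epsilon=\bigcap_{i=1}^J\{x:(a^i)^Tx\le1\}$, where the $a^i$ are the outer facet normals of $(1+\epsilon)P_\epsilon$ scaled so that $\phi^*(a^i)=1$. Put $\overline P_\epsilon=\widehat P_\epsilon\cap\{z\in\mathbb{R}^q:\ \mathbf e_i^Tz\le1,\ -\mathbf e_i^Tz\le1,\ i=1,\dots,q\}$. Fix a strictly decreasing positive sequence $\epsilon_k\in(0,\epsilon_0)$ with $\epsilon_k\to0$, and set $\mathcal Q_{\epsilon_j}=\bigcap_{k=1}^j\overline P_{\epsilon_k}$. Then $P_{\epsilon_j}\subseteq\mathfrak B^\phi\subseteq\mathcal Q_{\epsilon_j}\subseteq(1+\epsilon_j)P_{\epsilon_j}$. Let $\mathcal Y(\Gamma_{\mathcal Q_{\epsilon_j}})$ be the finite set of all vectors $a$ (each with $\phi^*(a)=1$) defining the half-spaces $a^Tz\le1$ in this construction of $\mathcal Q_{\epsilon_j}$ (including $\pm\mathbf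 e_i$), and $\Gamma_{\mathcal Q_{\epsilon_j}}$ the matrix with these vectors as columns, so that $\mathcal Q_{\epsilon_j}=\{z:(\Gamma_{\mathcal Q_{\epsilon_j}})^Tz\le\text{vector of ones}\}$. Solution set and relaxations: let $\varrho^*$ be the optimal value of $(\mathrm P)$, $S^*=\{x\in\mathbb{R}^n:\|x\|_1\le\varrho^*,\ \phi(M^T(Ax-y))\le\tau\}$ its set of optimal solutions, and $S_{\epsilon_j}=\{x\in\mathbb{R}^n:\|x\|_1\le\varrho^*,\ M^T(Ax-y)/\tau\in\mathcal Q_{\epsilon_j}\}$. (One has $d^{\mathcal H}(S^*,S_{\epsilon_j})\to0$ as $j\to\infty$, so a $j_0$ as required exists.) Robinson's constant: for $M'\in\mathbb{R}^{p_1\times r}$, $M''\in\mathbb{R}^{p_2\times r}$ let $$\mu_{\alpha_1,\alpha_2}(M',M'')=\max_{(d',d'')\in\mathcal F,\ \|(d',d'')\|_{\alpha_2}\le1}\ \min_{u\in\mathbb{R}^r}\{\|u\|_{\alpha_1}:\ M'u\le d',\ M''u=d''\},$$ with $\mathcal F=\{(d',d''):\ M'u\le d',\ M''u=d''\text{ for some }u\in\mathbb{R}^r\}$ (this is a finite number). For $N^1\in\mathbb{R}^{m_1\times\ell}$, $N^2\in\mathbb{R}^{m_2\times\ell}$, $$\sigma_{\alpha_1,\alpha_2}(N^1,N^2)=\max_{S\subseteq\{1,\dots,m_1\}}\mu_{\alpha_1,\alpha_2}\left(\begin{bmatrix}I_S&0\\-I&0\end{bmatrix},\begin{bmatrix}N^1\\N^2\end{bmatrix}^T\right),$$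 where $I$ is the $m_1\times m_1$ identity, $I_S$ consists of the rows of $I$ indexed by $S$, and the first matrix has $m_1+m_2$ columns. The matrices $\overline M^1,\overline M^2$: write $\Gamma=\Gamma_{\mathcal Q_{\epsilon_{j_0}}}\in\mathbb{R}^{q\times\widehat n}$; $\widetilde{\mathbf e}\in\mathbb{R}^n$, $\widehat{\mathbf e}\in\mathbb{R}^{\widehat n}$ are vectors of ones, $I$ is the $n\times n$ and $\widehat I$ the $\widehat n\times\widehat n$ identity; block columns have sizes $n,n,n,n,\widehat n$: $$\overline M^1=\begin{bmatrix} I&-I&0&0&0\\ -I&-I&0&0&0\\ 0&0&I&I&0\\ (M\Gamma)^TA&0&0&0&0\\ 0&-I&0&0&0\\ 0&0&-I&0&0\\ 0&0&0&-I&0\\ 0&0&0&0&-\widehat I \end{bmatrix},\qquad \overline M^2=\begin{bmatrix} 0&0&I&-I&A^TM\Gamma\\ 0&\widetilde{\mathbf e}^T&0&0&\tau\widehat{\mathbf e}^T+y^TM\Gamma \end{bmatrix}.$$ *)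

(* Defs.v *)
(* Vectors of R^p are column vectors, of type 'cV[R]_p. *)
From HB Require Import structures.
From mathcomp Require Export all_boot all_order all_algebra.
From mathcomp Require Export all_classical all_reals all_analysis.
Export Order.TTheory GRing.Theory Num.Theory.
Export numFieldNormedType.Exports.

Set Implicit Arguments.
Unset Strict Implicit.
Unset Printing Implicit Defensive.

Local Open Scope classical_set_scope.
Local Open Scope ring_scope.

Section Vectors.
Variable R : realType.

Definition dotp p (u v : 'cV[R]_p) : R := (u^T *m v) 0 0.

Definition unitvec p (i : 'I_p) : 'cV[R]_p := delta_mx i 0.

Definition lev p (u v : 'cV[R]_p) : Prop := forall i, u i 0 <= v i 0.

Definition l0norm p (x : 'cV[R]_p) : nat := #|[set i | x i 0 != 0]%SET|.
Definition l1norm p (x : 'cV[R]_p) : R := \sum_i `|x i 0|.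
Definition l2norm p (x : 'cV[R]_p) : R := Num.sqrt (\sum_i x i 0 ^+ 2).
(* The norm of matrices in MathComp-Analysis is the largest absolute value of
   an entry. *)
Definition linfnorm p (x : 'cV[R]_p) : R := `|x|.

Definition is_norm p (N : 'cV[R]_p -> R) : Prop :=
  [/\ forall x, N x = 0 -> x = 0,
      forall (a : R) x, N (a *: x) = `|a| * N x &
      forall x z, N (x + z) <= N x + N z].

Definition dual_norm p (N : 'cV[R]_p -> R) (u : 'cV[R]_p) : R :=
  sup [set dotp u x | x in [set x | N x <= 1]].

Definition unit_ball p (N : 'cV[R]_p -> R) : set 'cV[R]_p := [set x | N x <= 1].

(* ||Q||_{oo -> 1} *)
Definition norm_inf_1 p r (Q : 'M[R]_(p, r)) : R :=
  sup [set l1norm (Q *m x) | x in [set x | linfnorm x <= 1]].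

(* ||zeta_S||_1 *)
Definition l1norm_on p (S : {set 'I_p}) (x : 'cV[R]_p) : R :=
  \sum_(i in S) `|x i 0|.

(* sigma_k(x)_1 *)
Definition best_kterm_error p (k : nat) (x : 'cV[R]_p) : R :=
  inf [set l1norm (x - u) | u in [set u | (l0norm u <= k)%N]].

(* Valued in the extended reals, so that no convention on suprema of unbounded
   sets or infima of empty sets interferes. *)
Definition hausdorff_dist p (O1 O2 : set 'cV[R]_p) : \bar R :=
  Order.max
    (ereal_sup [set ereal_inf [set (l2norm (u - z))%:E | z in O2] | u in O1])
    (ereal_sup [set ereal_inf [set (l2norm (u - z))%:E | u in O1] | z in O2]).

End Vectors.

Section MatrixConditions.
Variables (R : realType) (m n : nat) (A : 'M[R]_(m, n)).

(* The summands are nonnegative, so the default value 0 of the maxima is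
   harmless; it also gives mu_1(0) = 0.  For k >= n the inner maxima are empty
   and the value is meaningless. *)
Definition coherence (k : nat) : R :=
  \big[Num.max/0]_(i < n)
   \big[Num.max/0]_(S : {set 'I_n} | (#|S| == k) && (i \notin S))
     \sum_(j in S) `|dotp (col i A) (col j A)|.

Definition coherence_property (k : nat) : Prop :=
  [/\ forall i, l2norm (col i A) = 1, (1 <= k <= n.-1)%N &
      coherence k + coherence k.-1 < 1].

Definition RIP (k : nat) (d : R) : Prop :=
  0 < d < 1 /\
  forall x : 'cV[R]_n, (l0norm x <= k)%N ->
    (1 - d) * l2norm x ^+ 2 <= l2norm (A *m x) ^+ 2 <= (1 + d) * l2norm x ^+ 2.

Definition NSP (k : nat) : Prop :=
  forall zeta : 'cV[R]_n, zeta != 0 -> A *m zeta = 0 ->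
  forall S : {set 'I_n}, (#|S| <= k)%N ->
    l1norm_on S zeta < l1norm_on (~: S) zeta.

Definition stable_NSP (k : nat) (rho : R) : Prop :=
  0 < rho < 1 /\
  forall zeta : 'cV[R]_n, zeta != 0 -> A *m zeta = 0 ->
  forall S : {set 'I_n}, (#|S| <= k)%N ->
    l1norm_on S zeta <= rho * l1norm_on (~: S) zeta.

Definition robust_NSP (k : nat) (N : 'cV[R]_m -> R) (rho1 rho2 : R) : Prop :=
  [/\ is_norm N, 0 < rho1 < 1, 0 < rho2 &
  forall (zeta : 'cV[R]_n) (S : {set 'I_n}), (#|S| <= k)%N ->
    l1norm_on S zeta <= rho1 * l1norm_on (~: S) zeta + rho2 * N (A *m zeta)].

(* The range space property of A^T. *)
Definition RSP (k : nat) : Prop :=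
  forall S1 S2 : {set 'I_n}, [disjoint S1 & S2]%B -> (#|S1| + #|S2| <= k)%N ->
  exists2 zeta : 'cV[R]_n, (exists w : 'cV[R]_m, zeta = A^T *m w) &
    [/\ forall i, i \in S1 -> zeta i 0 = 1,
        forall i, i \in S2 -> zeta i 0 = -1 &
        forall i, i \notin (S1 :|: S2)%SET -> `|zeta i 0| < 1].

End MatrixConditions.

Section Polytopes.
Variables (R : realType) (q : nat).
Implicit Types (P Q S : set 'cV[R]_q) (a x : 'cV[R]_q).

Definition convex_hull S : set 'cV[R]_q := smallest (@convex_set R 'cV[R]_q) S.

Definition polytope P : Prop := exists s : seq 'cV[R]_q, P = convex_hull [set` s].

Definition symmetric_set P : Prop := forall x, P x -> P (- x).

(* The vertices of a polytope are its extreme points. *)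
Definition vertices P : set 'cV[R]_q :=
  [set v | P v /\ forall x z (t : R), P x -> P z -> 0 < t < 1 ->
             v = t *: x + (1 - t) *: z -> x = v /\ z = v].

Definition dilate (r : R) P : set 'cV[R]_q := [set r *: x | x in P].

(* affdim S d: the affine hull of S has dimension d. *)
Definition affdim_ge S (d : nat) : Prop :=
  exists (x0 : 'cV[R]_q) (X : 'M[R]_(q, d)),
    [/\ S x0, forall i, S (x0 + col i X) & \rank X = d].
Definition affdim S (d : nat) : Prop := affdim_ge S d /\ ~ affdim_ge S d.+1.

(* a is an outer normal of a facet of Q. *)
Definition facet_normal Q a : Prop :=
  exists (b : R) (d : nat),
    [/\ forall x, Q x -> dotp a x <= b,
        affdim (Q `&` [set x | dotp a x = b]) d & affdim Q d.+1].

Variable phi : 'cV[R]_q -> R.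

Definition barvinok_polytope (chi eps : R) P : Prop :=
  [/\ polytope P, symmetric_set P,
      exists2 s : seq 'cV[R]_q, vertices P = [set` s] &
        (size s)%:R <= (chi / Num.sqrt eps * ln (1 / eps)) ^+ q,
      P `<=` unit_ball phi & unit_ball phi `<=` dilate (1 + eps) P].

(* The outer facet normals of (1 + eps) P, scaled to dual norm 1: shifting the
   facet with normal a until it touches the unit ball of phi produces the
   hyperplane a^T x = phi^*(a) = 1. *)
Definition scaled_normals (eps : R) P : set 'cV[R]_q :=
  [set a | facet_normal (dilate (1 + eps) P) a /\ dual_norm phi a = 1].

Definition Phat (eps : R) P : set 'cV[R]_q :=
  [set x | forall a, scaled_normals eps P a -> dotp a x <= 1].

Definition Pbar (eps : R) P : set 'cV[R]_q :=
  Phat eps P `&`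
  [set z | forall i, dotp (unitvec R i) z <= 1 /\ dotp (- unitvec R i) z <= 1].

(* P eps is the polytope chosen for eps; the sequence (eps_k) and the index j
   start from 1. *)
Definition Qpoly (P : R -> set 'cV[R]_q) (eps : nat -> R) (j : nat) :
    set 'cV[R]_q :=
  \bigcap_(k in [set k | (1 <= k <= j)%N]) Pbar (eps k) (P (eps k)).

Definition Qnormals (P : R -> set 'cV[R]_q) (eps : nat -> R) (j : nat) :
    set 'cV[R]_q :=
  (\bigcup_(k in [set k | (1 <= k <= j)%N]) scaled_normals (eps k) (P (eps k)))
  `|` [set a | exists i, a = unitvec R i \/ a = - unitvec R i].

(* The columns of Gamma enumerate Y, without repetition, in an arbitrary
   order. *)
Definition columns_enumerate p (Gamma : 'M[R]_(q, p)) (Y : set 'cV[R]_q) : Prop :=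
  injective (fun i => col i Gamma) /\ range (fun i => col i Gamma) = Y.

End Polytopes.

Section Problem.
Variables (R : realType) (m n q : nat).
Variables (A : 'M[R]_(m, n)) (M : 'M[R]_(m, q)) (y : 'cV[R]_m) (tau : R).
Variable phi : 'cV[R]_q -> R.

Definition residual (x : 'cV[R]_n) : 'cV[R]_q := M^T *m (A *m x - y).

Definition feasible (x : 'cV[R]_n) : Prop := phi (residual x) <= tau.

Definition optimal (x : 'cV[R]_n) : Prop :=
  feasible x /\ forall z, feasible z -> l1norm x <= l1norm z.

Definition optimal_value : R := inf [set l1norm x | x in feasible].

Definition Sstar : set 'cV[R]_n :=
  [set x | l1norm x <= optimal_value /\ feasible x].

Definition Srelax (Q : set 'cV[R]_q) : set 'cV[R]_n :=
  [set x | l1norm x <= optimal_value /\ Q (tau^-1 *: residual x)].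

(* M_G for |G| = m; columns in increasing order. *)
Definition colsubset (G : {set 'I_q}) (hG : #|G| = m) : 'M[R]_m :=
  colsub (fun i : 'I_m => enum_val (cast_ord (esym hG) i)) M.

Definition cconst : R :=
  sup [set v | exists (G : {set 'I_q}) (hG : #|G| = m),
         colsubset hG \in unitmx /\
         v = norm_inf_1 (invmx (colsubset hG) *m invmx (A *m A^T) *m A)].

End Problem.

Section Robinson.
Variable R : realType.
Variables N1 N2 : forall p, 'cV[R]_p -> R.

Definition lin_sys p1 p2 r (M1 : 'M[R]_(p1, r)) (M2 : 'M[R]_(p2, r))
    (d : 'cV[R]_p1 * 'cV[R]_p2) : set 'cV[R]_r :=
  [set u | lev (M1 *m u) d.1 /\ M2 *m u = d.2].

Definition robinson_mu p1 p2 r (M1 : 'M[R]_(p1, r)) (M2 : 'M[R]_(p2, r)) : R :=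
  sup [set inf [set N1 u | u in lin_sys M1 M2 d]
      | d in [set d | lin_sys M1 M2 d !=set0 /\ N2 (col_mx d.1 d.2) <= 1]].

(* All values of robinson_mu are nonnegative, so the default value 0 of the
   maximum is harmless. *)
Definition robinson_sigma m1 m2 l (K1 : 'M[R]_(m1, l)) (K2 : 'M[R]_(m2, l)) : R :=
  \big[Num.max/0]_(S : {set 'I_m1})
    robinson_mu
      (block_mx (rowsub (fun i : 'I_#|S| => enum_val i) 1%:M) (0 : 'M[R]_(#|S|, m2))
                (- 1%:M : 'M[R]_m1)                              0)
      (col_mx K1 K2)^T.

End Robinson.

Section BlockMatrices.
Variables (R : realType) (m n q nh : nat).
Variables (A : 'M[R]_(m, n)) (M : 'M[R]_(m, q)) (y : 'cV[R]_m) (tau : R).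
Variable Gamma : 'M[R]_(q, nh).

Definition row5 p (B1 B2 B3 B4 : 'M[R]_(p, n)) (B5 : 'M[R]_(p, nh)) :
    'M[R]_(p, n + (n + (n + (n + nh)))) :=
  row_mx B1 (row_mx B2 (row_mx B3 (row_mx B4 B5))).

Local Notation I := (1%:M : 'M[R]_n).
Local Notation Ih := (1%:M : 'M[R]_nh).

Definition Mbar1 :
    'M[R]_(n + (n + (n + (nh + (n + (n + (n + nh)))))),
           n + (n + (n + (n + nh)))) :=
  col_mx (row5 I                     (- I) 0     0     0)
 (col_mx (row5 (- I)                 (- I) 0     0     0)
 (col_mx (row5 0                     0     I     I     0)
 (col_mx (row5 ((M *m Gamma)^T *m A) 0     0     0     0)
 (col_mx (row5 0                     (- I) 0     0     0)
 (col_mx (row5 0                     0     (- I) 0     0)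
 (col_mx (row5 0                     0     0     (- I) 0)
         (row5 0                     0     0     0     (- Ih)))))))).

Definition Mbar2 : 'M[R]_(n + 1, n + (n + (n + (n + nh)))) :=
  col_mx
    (row5 0 0              I (- I) (A^T *m M *m Gamma))
    (row5 0 (const_mx 1)   0 0     (tau *: const_mx 1 + y^T *m M *m Gamma)).

Definition gammabar : R := robinson_sigma (@linfnorm R) (@l2norm R) Mbar1 Mbar2.

End BlockMatrices.

(* Main.v *)
Require Import Defs.
From mathcomp Require Import ring lra zify.

Set Implicit Arguments.
Unset Strict Implicit.
Unset Printing Implicit Defensive.

Local Open Scope classical_set_scope.
Local Open Scope ring_scope.

(* The relaxation of (P) with the polytope Q is a linear program, so its optimal
   solutions are the x-parts of the solutions of the KKT system whose matrices
   are Mbar1 and Mbar2.  Hoffman's error bound with Robinson's constant says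
   that every point lies within gammabar times its l1 constraint violation of
   the solution set of that system.

   Given x, take t = |x| and a dual vector built from the matrix condition:
   each of (a)-(f) yields zeta = A^T w with |zeta| <= 1 that agrees with the
   signs of the k largest entries of x.  Split zeta into its positive and
   negative parts, and write w = M h with |h|_1 <= c, h being supported on the
   columns of an invertible submatrix of M; the columns +-e_i of Gamma turn h
   into a nonnegative multiplier.  The only violated constraints are then those
   of the polytope (at most nhat (phi(..) - tau)^+ in total) and the duality gap
   (at most 2 sigma_k(x)_1 + c tau + c phi(..)).

   Passing from the relaxed solution to one of (P) costs delta; the spare factor
   2 in front of gammabar makes it unnecessary to show that the infimum in the
   Hausdorff distance is attained. *)

(** * Dot product and Euclidean norm *)

Section DotProduct.
Variables (R : realType) (p : nat).
Implicit Types (u v w : 'cV[R]_p) (a : R).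

Lemma coordD u v i : (u + v) i 0 = u i 0 + v i 0.
Proof. by rewrite mxE. Qed.

Lemma coordN u i : (- u) i 0 = - u i 0.
Proof. by rewrite mxE. Qed.

Lemma coordB u v i : (u - v) i 0 = u i 0 - v i 0.
Proof. by rewrite coordD coordN. Qed.

Lemma coordZ a u i : (a *: u) i 0 = a * u i 0.
Proof. by rewrite mxE. Qed.

Lemma dotpE u v : dotp u v = \sum_i u i 0 * v i 0.
Proof. by rewrite /dotp mxE; apply: eq_bigr => i _; rewrite mxE. Qed.

Lemma dotpC u v : dotp u v = dotp v u.
Proof. by rewrite !dotpE; apply: eq_bigr => i _; rewrite mulrC. Qed.

Lemma dotpDl u v w : dotp (u + v) w = dotp u w + dotp v w.
Proof. by rewrite /dotp linearD /= mulmxDl mxE. Qed.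

Lemma dotpDr u v w : dotp w (u + v) = dotp w u + dotp w v.
Proof. by rewrite /dotp mulmxDr mxE. Qed.

Lemma dotpZl a u v : dotp (a *: u) v = a * dotp u v.
Proof. by rewrite /dotp linearZ /= -scalemxAl mxE. Qed.

Lemma dotpZr a u v : dotp u (a *: v) = a * dotp u v.
Proof. by rewrite dotpC dotpZl dotpC. Qed.

Lemma dotpNl u v : dotp (- u) v = - dotp u v.
Proof. by rewrite -scaleN1r dotpZl mulN1r. Qed.

Lemma dotpNr u v : dotp u (- v) = - dotp u v.
Proof. by rewrite dotpC dotpNl dotpC. Qed.

Lemma dotp0l u : dotp 0 u = 0.
Proof. by rewrite -(scale0r 0) dotpZl mul0r. Qed.

Lemma dotp0r u : dotp u 0 = 0.
Proof. by rewrite dotpC dotp0l. Qed.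

Lemma dotp_suml (I : Type) (r : seq I) (P : pred I) (F : I -> 'cV[R]_p) v :
  dotp (\sum_(i <- r | P i) F i) v = \sum_(i <- r | P i) dotp (F i) v.
Proof.
by elim/big_rec2: _ => [|i y x _ <-]; rewrite ?dotp0l // dotpDl.
Qed.

Lemma dotp_sumr (I : Type) (r : seq I) (P : pred I) (F : I -> 'cV[R]_p) v :
  dotp v (\sum_(i <- r | P i) F i) = \sum_(i <- r | P i) dotp v (F i).
Proof. by rewrite dotpC dotp_suml; apply: eq_bigr => i _; rewrite dotpC. Qed.

Lemma dotp_unitvec i v : dotp (unitvec R i) v = v i 0.
Proof.
rewrite dotpE (bigD1 i) //= !mxE !eqxx mul1r big1 ?addr0 // => j /negbTE jNi.
by rewrite mxE jNi mul0r.
Qed.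

Lemma dotp_ge0 u v : lev 0 u -> lev 0 v -> 0 <= dotp u v.
Proof.
move=> u0 v0; rewrite dotpE sumr_ge0 // => i _.
by have := u0 i; have := v0 i; rewrite mxE => *; rewrite mulr_ge0.
Qed.

Lemma dotp_lev u v w : lev 0 u -> lev v w -> dotp u v <= dotp u w.
Proof.
move=> u0 vw; rewrite -subr_ge0 -dotpNr -dotpDr dotp_ge0 // => i.
by rewrite !mxE subr_ge0.
Qed.

Lemma l2norm_ge0 u : 0 <= l2norm u.
Proof. exact: sqrtr_ge0. Qed.

Lemma l2norm_sqr u : l2norm u ^+ 2 = dotp u u.
Proof.
rewrite sqr_sqrtr; last by rewrite sumr_ge0 // => i _; rewrite sqr_ge0.
by rewrite dotpE; apply: eq_bigr => i _; rewrite expr2.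
Qed.

Lemma dotp_diag_ge0 u : 0 <= dotp u u.
Proof. by rewrite -l2norm_sqr sqr_ge0. Qed.

Lemma dotp_diag_eq0 u : dotp u u = 0 -> u = 0.
Proof.
rewrite dotpE => /eqP; rewrite psumr_eq0; last first.
  by move=> i _; rewrite -expr2 sqr_ge0.
move=> /allP u0; apply/matrixP => i j; rewrite ord1 mxE.
by have := u0 i (mem_index_enum i); rewrite /= -expr2 sqrf_eq0 => /eqP.
Qed.

Lemma l2normE u : l2norm u = Num.sqrt (dotp u u).
Proof. by rewrite -l2norm_sqr sqrtr_sqr ger0_norm // l2norm_ge0. Qed.

Lemma l2normZ a u : l2norm (a *: u) = `|a| * l2norm u.
Proof.
by rewrite !l2normE dotpZl dotpZr mulrA -expr2 sqrtrM ?sqr_ge0 // sqrtr_sqr.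
Qed.

Lemma l2normN u : l2norm (- u) = l2norm u.
Proof. by rewrite -scaleN1r l2normZ normrN1 mul1r. Qed.

Lemma dotp_le_l2norm u v : dotp u v <= l2norm u * l2norm v.
Proof.
have [/eqP u0|u0] := boolP (l2norm u == 0).
  have : u = 0 by apply: dotp_diag_eq0; rewrite -l2norm_sqr u0 expr0n.
  by move=> ->; rewrite dotp0l mulr_ge0 // l2norm_ge0.
have [/eqP v0|v0] := boolP (l2norm v == 0).
  have : v = 0 by apply: dotp_diag_eq0; rewrite -l2norm_sqr v0 expr0n.
  by move=> ->; rewrite dotp0r mulr_ge0 // l2norm_ge0.
have uv : 0 < l2norm u * l2norm v by rewrite mulr_gt0 // lt0r ?u0 ?v0 l2norm_ge0.
(* Cauchy-Schwarz: the squared norm of this vector is [2 * (l2norm u * l2norm v)] times the gap to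
   be shown nonnegative. *)
have := dotp_diag_ge0 (l2norm v *: u - l2norm u *: v).
rewrite !(dotpDl, dotpDr, dotpNl, dotpNr, dotpZl, dotpZr).
rewrite (dotpC v u) -!l2norm_sqr.
rewrite [X in 0 <= X](_ : _ =
   2 * (l2norm u * l2norm v) * (l2norm u * l2norm v - dotp u v)); last by ring.
by rewrite pmulr_rge0 ?subr_ge0 // mulr_gt0.
Qed.

Lemma ler_l2normD u v : l2norm (u + v) <= l2norm u + l2norm v.
Proof.
rewrite -(@ler_pXn2r _ 2) ?nnegrE ?addr_ge0 ?l2norm_ge0 //.
rewrite sqrrD !l2norm_sqr dotpDl !dotpDr (dotpC v u).
by have := dotp_le_l2norm u v; lra.
Qed.

Lemma ler_coord_l2norm u i : `|u i 0| <= l2norm u.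
Proof.
rewrite -sqrtr_sqr ler_wsqrtr // (bigD1 i) //= lerDl sumr_ge0 // => j _.
exact: sqr_ge0.
Qed.

End DotProduct.

Lemma dotp_mulmx (R : realType) p r (B : 'M[R]_(p, r)) u v :
  dotp u (B *m v) = dotp (B^T *m u) v.
Proof. by rewrite /dotp trmx_mul trmxK mulmxA. Qed.

Lemma dotp_col_mx (R : realType) p r (u1 v1 : 'cV[R]_p) (u2 v2 : 'cV[R]_r) :
  dotp (col_mx u1 u2) (col_mx v1 v2) = dotp u1 v1 + dotp u2 v2.
Proof. by rewrite /dotp tr_col_mx mul_row_col mxE. Qed.

Lemma lev_col_mx (R : realType) p r (u1 v1 : 'cV[R]_p) (u2 v2 : 'cV[R]_r) :
  lev (col_mx u1 u2) (col_mx v1 v2) <-> lev u1 v1 /\ lev u2 v2.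
Proof.
split=> [uv|[uv1 uv2] i].
  split=> i.
    by have := uv (lshift r i); rewrite !col_mxEu.
  by have := uv (rshift p i); rewrite !col_mxEd.
by case: (split_ordP i) => j ->; rewrite ?col_mxEu ?col_mxEd.
Qed.

Lemma lev0_col_mx (R : realType) p r (u : 'cV[R]_p) (v : 'cV[R]_r) :
  lev 0 (col_mx u v) <-> lev 0 u /\ lev 0 v.
Proof. by rewrite -[0]col_mx0; exact: lev_col_mx. Qed.

Lemma lev_col_mx0 (R : realType) p r (u : 'cV[R]_p) (v : 'cV[R]_r) :
  lev (col_mx u v) 0 <-> lev u 0 /\ lev v 0.
Proof. by rewrite -[0]col_mx0; exact: lev_col_mx. Qed.

Lemma lev_sub0 (R : realType) p (u v : 'cV[R]_p) : lev (u - v) 0 <-> lev u v.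
Proof. by split=> h i; have := h i; rewrite !mxE subr_le0. Qed.

Lemma lev_opp0 (R : realType) p (u : 'cV[R]_p) : lev (- u) 0 <-> lev 0 u.
Proof. by split=> h i; have := h i; rewrite !mxE oppr_le0. Qed.

Lemma mulmx_coord (R : realType) p r (B : 'M[R]_(p, r)) (u : 'cV[R]_r) i :
  (B *m u) i 0 = dotp (row i B)^T u.
Proof. by rewrite /dotp trmxK -row_mul [RHS]mxE. Qed.

(** * Farkas' lemma *)

Section Farkas.
Variable R : realType.

(* Bartl's induction: if the constraint [i] cannot be dropped, some [xb]
   violates the conclusion with [a i xb = 1] after scaling, and projecting
   along [xb] onto the hyperplane [a i = 0] removes the constraint. *)
Lemma farkas_seq (I : eqType) p (r : seq I) (a : I -> 'cV[R]_p) (g : 'cV[R]_p) :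
  uniq r ->
  (forall x, (forall i, i \in r -> dotp (a i) x <= 0) -> dotp g x <= 0) ->
  exists2 l : I -> R, forall i, 0 <= l i & g = \sum_(i <- r) l i *: a i.
Proof.
elim: r a g => [|i r IH] a g /=.
  move=> _ g0; exists (fun=> 0) => //; rewrite big_nil.
  have gg : dotp g g <= 0 by apply: g0.
  by apply: dotp_diag_eq0; apply/eqP; rewrite eq_le gg dotp_diag_ge0.
move=> /andP[iNr ur] ag.
have updE (l : I -> R) c (b : I -> 'cV[R]_p) :
    \sum_(j <- r) (if j == i then c else l j) *: b j = \sum_(j <- r) l j *: b j.
  rewrite !big_seq; apply: eq_bigr => j jr.
  by case: eqP jr iNr => // -> ->.
have [ag'|] := pselect (forall x, (forall j, j \in r -> dotp (a j) x <= 0) ->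
    dotp g x <= 0).
  have [l l0 gE] := IH a g ur ag'.
  exists (fun j => if j == i then 0 else l j) => [j|]; first by case: ifP.
  by rewrite big_cons eqxx scale0r add0r updE.
move=> /existsNP[x0 /not_implyP[x0r /negP]]; rewrite -ltNge => gx0.
have ax0 : 0 < dotp (a i) x0.
  rewrite ltNge; apply/negP => ax0; move: gx0; rewrite ltNge => /negP; apply.
  by apply: ag => j; rewrite inE => /predU1P[-> //|]; apply: x0r.
pose xb := (dotp (a i) x0)^-1 *: x0.
have axb : dotp (a i) xb = 1 by rewrite dotpZr mulVf // gt_eqF.
have gxb : 0 < dotp g xb by rewrite dotpZr mulr_gt0 // invr_gt0.
have rxb j : j \in r -> dotp (a j) xb <= 0.
  by move=> jr; rewrite dotpZr pmulr_rle0 ?invr_gt0 // x0r.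
clearbody xb.
pose a' j := a j - dotp (a j) xb *: a i.
have [|l l0 gE] := IH a' (g - dotp g xb *: a i) ur.
  move=> x xr.
  have ax' b : dotp (b - dotp b xb *: a i) x =
      dotp b (x - dotp (a i) x *: xb).
    rewrite dotpDl dotpDr dotpNl dotpNr dotpZl dotpZr.
    by rewrite mulrC.
  rewrite ax'; apply: ag => j; rewrite inE => /predU1P[->|jr].
    by rewrite dotpDr dotpNr dotpZr axb mulr1 subrr.
  by rewrite -ax' xr.
pose c := dotp g xb - \sum_(j <- r) l j * dotp (a j) xb.
have c0 : 0 <= c.
  rewrite subr_ge0 (le_trans _ (ltW gxb)) // big_seq sumr_le0 // => j jr.
  by rewrite mulr_ge0_le0 // rxb.
exists (fun j => if j == i then c else l j) => [j|]; first by case: ifP.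
rewrite big_cons eqxx updE.
move/eqP: gE; rewrite subr_eq => /eqP ->.
rewrite /a' (eq_bigr (fun j => l j *: a j - (l j * dotp (a j) xb) *: a i)).
  rewrite sumrB -scaler_suml /c scalerBl -addrA addrC.
  by congr (_ + _); rewrite addrC.
by move=> j _; rewrite scalerBr scalerA.
Qed.

Lemma farkas_fin (I : finType) p (a : I -> 'cV[R]_p) (g : 'cV[R]_p) :
  (forall x, (forall i, dotp (a i) x <= 0) -> dotp g x <= 0) ->
  exists2 l : I -> R, forall i, 0 <= l i & g = \sum_i l i *: a i.
Proof.
move=> ag; apply: farkas_seq; first exact: index_enum_uniq.
by move=> x xr; apply: ag => i; apply: xr; rewrite mem_index_enum.
Qed.

Lemma mulmx_tr_sum_row p r (B : 'M[R]_(p, r)) (l : 'cV[R]_p) :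
  B^T *m l = \sum_i l i 0 *: (row i B)^T.
Proof.
apply/matrixP => j k; rewrite ord1 mxE summxE.
by apply: eq_bigr => i _; rewrite !mxE mulrC.
Qed.

Lemma farkas p1 p2 r (N1 : 'M[R]_(p1, r)) (N2 : 'M[R]_(p2, r)) (g : 'cV[R]_r) :
  (forall x, lev (N1 *m x) 0 -> N2 *m x = 0 -> dotp g x <= 0) ->
  exists (l : 'cV[R]_p1) (s : 'cV[R]_p2),
    lev 0 l /\ g = N1^T *m l + N2^T *m s.
Proof.
move=> Ng.
(* Each equation enters as two opposite inequalities; its free multiplier is the difference of their
   multipliers. *)
pose a (i : 'I_p1 + ('I_p2 + 'I_p2)) := match i with
  | inl i => (row i N1)^T | inr (inl i) => (row i N2)^T
  | inr (inr i) => - (row i N2)^T end.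
have [|l l0 ->] := @farkas_fin _ r a g.
  move=> x xa; apply: Ng.
    by move=> i; rewrite mulmx_coord mxE; apply: (xa (inl i)).
  apply/matrixP => i j; rewrite ord1 mulmx_coord mxE.
  have := xa (inr (inl i)); have := xa (inr (inr i)).
  rewrite /= dotpNl oppr_le0 => h1 h2.
  by apply/eqP; rewrite eq_le h1 h2.
exists (\col_i l (inl i)), (\col_i (l (inr (inl i)) - l (inr (inr i)))).
split=> [i|]; first by rewrite !mxE.
rewrite big_sumType /= big_sumType /= !mulmx_tr_sum_row; congr (_ + _).
  by apply: eq_bigr => i _; rewrite mxE.
rewrite -big_split /=; apply: eq_bigr => i _.
by rewrite mxE scalerBl scalerN.
Qed.

(** Homogenization: with an extra variable [t >= 0] scaling the right-hand sides, infeasibility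
    means that the homogeneous system forces [t <= 0]. Applying [farkas] to this consequence yields
    the certificate. *)
Lemma farkas_affine p1 p2 r (N1 : 'M[R]_(p1, r)) (N2 : 'M[R]_(p2, r)) d1 d2 :
  (forall u, lev (N1 *m u) d1 -> N2 *m u = d2 -> False) ->
  exists (l : 'cV[R]_p1) (s : 'cV[R]_p2),
    [/\ lev 0 l, N1^T *m l + N2^T *m s = 0 & dotp d1 l + dotp d2 s < 0].
Proof.
move=> infeasible.
pose K1 := block_mx N1 (- d1) 0 (- 1%:M) : 'M[R]_(p1 + 1, r + 1).
pose K2 := row_mx N2 (- d2).
have [x|l [s [l0]]] := @farkas _ _ _ K1 K2 (col_mx 0 1%:M).
  rewrite -[x]vsubmxK [dsubmx x]mx11_scalar.
  move: (usubmx x) (dsubmx x 0 0) => u t {x}.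
  rewrite mul_block_col mul_row_col mul0mx add0r !mulNmx mul1mx !mul_mx_scalar.
  move=> /lev_col_mx0[h1 h2] h3.
  rewrite dotp_col_mx dotp0l add0r dotpE big_ord1 !mxE mul1r mulr1n.
  rewrite leNgt; apply/negP => t0; apply: (infeasible (t^-1 *: u)).
    move=> i; rewrite -scalemxAr mxE ler_pdivrMl //.
    by have := h1 i; rewrite !mxE subr_le0.
  move/eqP: h3; rewrite -scalemxAr subr_eq0 => /eqP ->.
  by rewrite scalerA mulVf ?scale1r // gt_eqF.
move: l0; rewrite -[l]vsubmxK; move: (usubmx l) (dsubmx l) => l1 l2 {l}.
move=> /lev0_col_mx[l1_ge0 l2_ge0].
rewrite tr_block_mx tr_row_mx mul_block_col mul_col_mx add_col_mx trmx0.
rewrite mul0mx addr0 => /eq_col_mx[e1 e2].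
exists l1, s; split=> //.
move/matrixP/(_ 0 0): e2.
rewrite !linearN /= trmx1 !mulNmx mul1mx !mxE /= => e2.
have := l2_ge0 0; rewrite mxE /dotp => l2_0.
rewrite !mxE; move: e2; set X := \sum_i _; set Y := \sum_i _.
by move=> e2; lra.
Qed.

End Farkas.

(** * Robinson's constant and Hoffman's error bound *)

Section BoundedSolutions.
Variable R : realType.

Lemma ler_coord_linfnorm p (x : 'cV[R]_p) i : `|x i 0| <= linfnorm x.
Proof.
rewrite /linfnorm [leRHS]/Num.norm /= mx_normrE.
by apply/bigmax_geP; right => /=; exists (i, 0).
Qed.

Lemma linfnorm_le p (x : 'cV[R]_p) C :
  0 <= C -> (forall i, `|x i 0| <= C) -> linfnorm x <= C.
Proof.
move=> C0 xC; rewrite /linfnorm [leLHS]/Num.norm /= mx_normrE.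
by apply/bigmax_leP; split=> // -[i j] _ /=; rewrite ord1.
Qed.

Lemma linfnorm_ge0 p (x : 'cV[R]_p) : 0 <= linfnorm x.
Proof. exact: normr_ge0. Qed.

Lemma linfnorm_mulmx p r (L : 'M[R]_(p, r)) (v : 'cV[R]_r) :
  linfnorm (L *m v) <= (\sum_i \sum_j `|L i j|) * linfnorm v.
Proof.
have sum0 i : 0 <= \sum_j `|L i j| by rewrite sumr_ge0.
apply: linfnorm_le => [|i].
  by rewrite mulr_ge0 ?linfnorm_ge0 // sumr_ge0.
apply: (@le_trans _ _ ((\sum_j `|L i j|) * linfnorm v)).
  rewrite mxE (le_trans (ler_norm_sum _ _ _)) // mulr_suml ler_sum // => j _.
  by rewrite normrM ler_wpM2l // ler_coord_linfnorm.
rewrite ler_wpM2r ?linfnorm_ge0 // (bigD1 i) //= lerDl sumr_ge0 //.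
Qed.

(** The kernel of [B *m D] lies in that of [D], the projection onto the coordinates in [S], so [D]
    factors through [B *m D]. The factor is a left inverse of [B] on vectors supported in [S], and
    its entries give [C]. *)
Lemma injective_on_bounded p N (B : 'M[R]_(p, N)) (S : {set 'I_N}) :
  (forall u : 'cV[R]_N, (forall i, i \notin S -> u i 0 = 0) -> B *m u = 0 ->
     u = 0) ->
  exists2 C, 0 <= C & forall u : 'cV[R]_N, (forall i, i \notin S -> u i 0 = 0) ->
    linfnorm u <= C * linfnorm (B *m u).
Proof.
move=> injB; pose D : 'M[R]_N := diag_mx (\row_i (i \in S)%:R).
have DE (u : 'cV[R]_N) i : (D *m u) i 0 = (i \in S)%:R * u i 0.
  by rewrite mul_diag_mx !mxE.
have DB : (D <= B *m D)%MS.
  rewrite submxE; apply/eqP/matrixP => i j.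
  have /matrixP/(_ i 0) : D *m col j (cokermx (B *m D)) = 0.
    apply: injB => [k kS|]; first by rewrite DE (negbTE kS) mul0r.
    by rewrite colE (mulmxA D) mulmxA (mulmxA B) mulmx_coker mul0mx.
  by rewrite colE mulmxA -colE !mxE.
exists (\sum_i \sum_j `|(D *m pinvmx (B *m D)) i j|) => [|u uS].
  by rewrite sumr_ge0 // => i _; rewrite sumr_ge0.
have uD : D *m u = u.
  apply/matrixP => i j; rewrite ord1 DE.
  by case: (boolP (i \in S)) => iS; rewrite ?mul1r // mul0r uS.
rewrite -[X in linfnorm X <= _]uD -[X in linfnorm (X *m _)](mulmxKpV DB).
rewrite -(mulmxA _ (B *m D)) -(mulmxA B) uD.
exact: linfnorm_mulmx.
Qed.

(* A dependency among the generators indexed by [S] allows to move along it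
   until one coefficient vanishes; so only independent subfamilies matter. *)
Lemma conic_bounded_on p N (B : 'M[R]_(p, N)) (S : {set 'I_N}) :
  exists2 C, 0 <= C & forall l : 'cV[R]_N,
    lev 0 l -> (forall i, i \notin S -> l i 0 = 0) ->
    exists2 l' : 'cV[R]_N, lev 0 l' &
      B *m l' = B *m l /\ linfnorm l' <= C * linfnorm (B *m l).
Proof.
have [s] := ubnP #|S|; elim: s => // s IH in S *; rewrite ltnS => Ss.
have [[v0 [v0S Bv0 v0N0]]|indep] := pselect (exists u : 'cV[R]_N,
    [/\ forall i, i \notin S -> u i 0 = 0, B *m u = 0 & u != 0]); last first.
  have [u uS Bu|C C0 HC] := @injective_on_bounded p N B S.
    by apply/eqP/negP => /negP u0; apply: indep; exists u.
  by exists C => // l l0 lS; exists l => //; split=> //; apply: HC.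
have [v [vS Bv [i1 vi1]]] : exists v : 'cV[R]_N,
    [/\ forall i, i \notin S -> v i 0 = 0, B *m v = 0 & exists i, 0 < v i 0].
  have [i v0i] : exists i, v0 i 0 != 0.
    apply: contrapT => /forallNP v0_0; move/eqP: v0N0; apply.
    apply/matrixP => i j; rewrite ord1 mxE.
    by have /negP/negPn/eqP := v0_0 i.
  have [vi|vi|/eqP] := ltgtP 0 (v0 i 0); last by rewrite eq_sym (negbTE v0i).
    by exists v0; split=> //; exists i.
  exists (- v0); split=> [j /v0S|//|]; first by rewrite mxE => ->; rewrite oppr0.
    by rewrite mulmxN Bv0 oppr0.
  by exists i; rewrite mxE oppr_gt0.
have /choice[Cf HCf] : forall i, exists C, 0 <= C /\ (i \in S ->
    forall l : 'cV[R]_N, lev 0 l -> (forall j, j \notin S :\ i -> l j 0 = 0) ->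
    exists2 l' : 'cV[R]_N, lev 0 l' &
      B *m l' = B *m l /\ linfnorm l' <= C * linfnorm (B *m l)).
  move=> i; have [iS|_] := boolP (i \in S); last by exists 0.
  have [|C C0 HC] := IH (S :\ i)%SET; last by exists C.
  by rewrite (leq_trans _ Ss) // [X in (_ < X)%N](cardsD1 i) iS.
(* The sum serves whichever index is removed. *)
exists (\sum_i Cf i) => [|l l0 lS].
  by rewrite sumr_ge0 // => i _; case: (HCf i).
(* Ratio test: the smallest ratio over [v i 0 > 0] is the longest step along [- v] that keeps all
   coefficients nonnegative. *)
pose f i := l i 0 / v i 0.
case: (@Order.TotalTheory.arg_minP _ R _ i1 (fun i => 0 < v i 0) f vi1) => i vi fmin.
have iS : i \in S by apply: contraT => /vS vi0; rewrite vi0 ltxx in vi.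
have l0' j : 0 <= l j 0 by have := l0 j; rewrite mxE.
have [|j|l' l'0 [Bl' l'C]] := (HCf i).2 iS (l - f i *: v).
- move=> j; rewrite !mxE subr_ge0.
  have [vj|vj] := ltP 0 (v j 0); first by rewrite -ler_pdivlMr // fmin.
  by rewrite (le_trans _ (l0' j)) // mulr_ge0_le0 // divr_ge0 // ltW.
- rewrite !inE negb_and negbK !mxE => /orP[/eqP ->|jS].
    by rewrite /f divfK ?gt_eqF // subrr.
  by rewrite lS // vS // mulr0 subr0.
- have BE : B *m (l - f i *: v) = B *m l.
    by rewrite mulmxBr -scalemxAr Bv scaler0 subr0.
  rewrite BE in Bl' l'C; exists l' => //; split=> //.
  rewrite (le_trans l'C) // ler_wpM2r ?linfnorm_ge0 // (bigD1 i) //= lerDl.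
  by rewrite sumr_ge0 // => j _; case: (HCf j).
Qed.

(** Makes the supremum in [robinson_mu] finite. Writing [u] as a difference of nonnegative vectors
    and adding slacks turns the system into a conic combination, to which [conic_bounded_on]
    applies; the difference costs the factor 2. *)
Lemma lin_sys_bounded p1 p2 r (M1 : 'M[R]_(p1, r)) (M2 : 'M[R]_(p2, r)) :
  exists2 C, 0 <= C & forall d, lin_sys M1 M2 d !=set0 ->
    exists2 u, lin_sys M1 M2 d u & linfnorm u <= C * l2norm (col_mx d.1 d.2).
Proof.
pose B := col_mx (row_mx M1 (row_mx (- M1) 1%:M)) (row_mx M2 (row_mx (- M2) 0)).
have BE (a b : 'cV[R]_r) (c : 'cV[R]_p1) :
    B *m col_mx a (col_mx b c) = col_mx (M1 *m (a - b) + c) (M2 *m (a - b)).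
  rewrite mul_col_mx !mul_row_col !mulNmx mul1mx mul0mx addr0 !mulmxBr.
  by rewrite addrA.
have [C C0 HC] := @conic_bounded_on _ _ B [set: _]%SET.
exists (2 * C) => [|[d1 d2] [u [/= M1u M2u]]]; first by rewrite mulr_ge0.
pose up : 'cV[R]_r := \col_i Num.max (u i 0) 0.
pose un : 'cV[R]_r := \col_i Num.max (- u i 0) 0.
have uE : up - un = u.
  by apply/matrixP => i j; rewrite ord1 !mxE !maxEle; do 2!case: ifP; lra.
have [||l' l'0 []] := HC (col_mx up (col_mx un (d1 - M1 *m u))).
- apply/lev0_col_mx; split=> [i|]; first by rewrite !mxE le_max lexx orbT.
  apply/lev0_col_mx; split=> i; first by rewrite !mxE le_max lexx orbT.
  by have := M1u i; rewrite !mxE subr_ge0.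
- by move=> i; rewrite inE.
rewrite BE uE addrC subrK M2u => Bl' l'C.
move: l'0 Bl' l'C.
rewrite -[l']vsubmxK -[dsubmx l']vsubmxK.
set a := usubmx l'; set b := usubmx (dsubmx l'); set c := dsubmx (dsubmx l').
rewrite BE => l'0 /eq_col_mx[e1 e2] l'C.
have c0 : lev 0 c by case/lev0_col_mx: l'0 => _ /lev0_col_mx[].
have dC : linfnorm (col_mx d1 d2) <= l2norm (col_mx d1 d2).
  by apply: linfnorm_le (l2norm_ge0 _) _ => i; apply: ler_coord_l2norm.
exists (a - b).
  split=> //= i; rewrite -e1 [leRHS]mxE lerDl.
  by have := c0 i; rewrite mxE.
apply: linfnorm_le => [|i]; first by rewrite !mulr_ge0 // l2norm_ge0.
have ha : `|a i 0| <= C * l2norm (col_mx d1 d2).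
  apply: le_trans (le_trans l'C _); last by rewrite ler_wpM2l.
  by have := ler_coord_linfnorm (col_mx a (col_mx b c)) (lshift _ i); rewrite col_mxEu.
have hb : `|b i 0| <= C * l2norm (col_mx d1 d2).
  apply: le_trans (le_trans l'C _); last by rewrite ler_wpM2l.
  have := ler_coord_linfnorm (col_mx a (col_mx b c)) (rshift _ (lshift _ i)).
  by rewrite col_mxEd col_mxEu.
by rewrite coordB (le_trans (ler_normB _ _)) // -mulrA mulr_natl mulr2n lerD.
Qed.

(** A lower bound on [sup] needs its set to be bounded above; [lin_sys_bounded] provides this. *)
Lemma le_robinson_mu p1 p2 r (M1 : 'M[R]_(p1, r)) (M2 : 'M[R]_(p2, r)) d c :
  lin_sys M1 M2 d !=set0 -> l2norm (col_mx d.1 d.2) <= 1 ->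
  (forall u, lin_sys M1 M2 d u -> c <= linfnorm u) ->
  c <= robinson_mu (@linfnorm R) (@l2norm R) M1 M2.
Proof.
move=> dF d1 cu.
apply: (@le_trans _ _ (inf [set linfnorm u | u in lin_sys M1 M2 d])).
  apply: lb_le_inf; last by move=> _ [u du <-]; apply: cu.
  by case: dF => u du; exists (linfnorm u), u.
apply: ub_le_sup; last by exists d.
have [C C0 HC] := lin_sys_bounded M1 M2.
exists C => _ [d' [d'F d'1] <-].
have [u d'u uC] := HC d' d'F.
apply: (@le_trans _ _ (linfnorm u)).
  by apply: ge_inf; [exists 0 => _ [v _ <-]; exact: linfnorm_ge0 | exists u].
by rewrite (le_trans uC) // ler_piMr.
Qed.

End BoundedSolutions.

(** * Projection onto a polyhedron and Hoffman's bound *)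

Section Hoffman.
Variable R : realType.

Lemma coord_mulmx_tr_continuous p r (B : 'M[R]_(p, r)) i :
  continuous (fun v : 'rV[R]_r => (B *m v^T) i 0 : R).
Proof.
have -> : (fun v : 'rV[R]_r => (B *m v^T) i 0) =
    (fun v => \sum_j (B i j * v 0 j)).
  by apply/funext => v; rewrite mxE; apply: eq_bigr => j _; rewrite mxE.
apply: continuous_big => [|j _]; first exact: add_continuous.
move=> v; apply: continuousM; first exact: cst_continuous.
exact: coord_continuous.
Qed.

(** The squared distance is minimized over the part of the polyhedron no farther from [x] than a
    given point of it, which is compact. Points are transposed to rows for [EVT_min_rV]. *)
Lemma polyhedron_projection p1 p2 l (K1 : 'M[R]_(p1, l)) (K2 : 'M[R]_(p2, l))
    d (x : 'cV[R]_l) :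
  lin_sys K1 K2 d !=set0 ->
  exists2 z, lin_sys K1 K2 d z &
    forall z', lin_sys K1 K2 d z' -> dotp (x - z) (x - z) <= dotp (x - z') (x - z').
Proof.
case: d => d1 d2 [z0 z0Z].
pose f (v : 'rV[R]_l) : R := dotp (x - v^T) (x - v^T).
have fc : continuous f.
  have -> : f = (fun v => \sum_i ((x i 0 - (1%:M *m v^T) i 0) * (x i 0 - (1%:M *m v^T) i 0))).
    by apply/funext => v; rewrite /f dotpE; apply: eq_bigr => i _; rewrite mul1mx !mxE.
  apply: continuous_big => [|i _]; first exact: add_continuous.
  have c v : {for v, continuous (fun v : 'rV[R]_l => x i 0 - (1%:M *m v^T) i 0 : R)}.
    apply: continuousB; first exact: cst_continuous.
    exact: coord_mulmx_tr_continuous.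
  by move=> v; exact: (continuousM (c v) (c v)).
pose Z1 := \bigcap_(i in [set: 'I_p1]) [set v : 'rV[R]_l | (K1 *m v^T) i 0 <= d1 i 0].
pose Z2 := \bigcap_(i in [set: 'I_p2]) [set v : 'rV[R]_l | (K2 *m v^T) i 0 = d2 i 0].
pose Z := [set v : 'rV[R]_l | f v <= f z0^T] `&` (Z1 `&` Z2).
have ZE v : Z1 v /\ Z2 v <-> lin_sys K1 K2 (d1, d2) v^T.
  split=> [[v1 v2]|[v1 v2]].
    split=> [i|/=]; first exact: (v1 i).
    by apply/matrixP => i j; rewrite ord1 (v2 i).
  by split=> i _ /=; [apply: v1|rewrite v2].
have Zz0 : Z z0^T by split=> /=; [exact: lexx|apply/ZE; rewrite trmxK].
have Zc : compact Z.
  apply: bounded_closed_compact.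
    exists (\sum_i `|x i 0| + Num.sqrt (f z0^T)); split; first exact: num_real.
    move=> M ltM v [/= fv _]; apply: le_trans (ltW ltM).
    rewrite [leLHS]/Num.norm /= mx_normrE; apply/bigmax_leP; split=> [|[a i] _ /=].
      by rewrite addr_ge0 ?sqrtr_ge0 // sumr_ge0.
    rewrite ord1.
    have -> : v 0 i = x i 0 - (x - v^T) i 0 by rewrite !mxE; ring.
    rewrite (le_trans (ler_normB _ _)) // lerD //.
      by rewrite (bigD1 i) //= lerDl sumr_ge0.
    rewrite (le_trans (ler_coord_l2norm _ _)) // l2normE ler_wsqrtr //.
  apply: closedI.
    by apply: (@preimage_closed _ _ f) (@closed_le _ _) => v _; exact: fc.
  apply: closedI; apply: closed_bigI => i _.
    apply: (@preimage_closed _ _ (fun v : 'rV[R]_l => (K1 *m v^T) i 0))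
      (@closed_le _ _) => v _; exact: coord_mulmx_tr_continuous.
  apply: (@preimage_closed _ _ (fun v : 'rV[R]_l => (K2 *m v^T) i 0))
      (@closed_eq _ _) => v _; exact: coord_mulmx_tr_continuous.
have fcZ : {within Z, continuous f} by apply: continuous_subspaceT; exact: fc.
have [c cZ cmin] := EVT_min_rV (ex_intro _ _ Zz0) Zc fcZ.
move: cZ; rewrite inE => -[/= cz0 /ZE cZ].
exists c^T => // z' z'Z; have [lez|/ltW gez] := leP (f z'^T) (f z0^T).
  suff : f c <= f z'^T by rewrite /f !trmxK.
  apply: cmin; rewrite inE; split=> //=.
  by apply/ZE; rewrite trmxK.
by move: (le_trans cz0 gez); rewrite /f !trmxK.
Qed.

(** Optimality condition of the projection: [x - z] makes no acute angle with a feasible direction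
    at [z], so [farkas] writes it as a conic combination of active rows plus a combination of the
    equations. *)
Lemma polyhedron_projection_normal p1 p2 l (K1 : 'M[R]_(p1, l))
    (K2 : 'M[R]_(p2, l)) d (x : 'cV[R]_l) :
  lin_sys K1 K2 d !=set0 ->
  exists2 z, lin_sys K1 K2 d z &
    exists (u1 : 'cV[R]_p1) (u2 : 'cV[R]_p2),
    [/\ lev 0 u1, forall i, (K1 *m z) i 0 < d.1 i 0 -> u1 i 0 = 0 &
        x - z = K1^T *m u1 + K2^T *m u2].
Proof.
move=> /polyhedron_projection-/(_ x)[z zZ zmin]; exists z => //.
have [w wdef] : exists w, w = x - z by exists (x - z).
rewrite -wdef in zmin *.
case: (zZ) => /= K1z K2z.
have var e : lin_sys K1 K2 d (z + e) -> dotp w e <= 0.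
  case=> /= K1e K2e; rewrite leNgt; apply/negP => we.
  have K2e0 : K2 *m e = 0.
    by move: K2e; rewrite mulmxDr K2z => /eqP; rewrite addrC -subr_eq0 addrK => /eqP.
  pose b := dotp e e; have b0 : 0 <= b := dotp_diag_ge0 e.
  have ab : 0 < dotp w e + b by rewrite ltr_wpDr.
  (* Here [0 < s <= 1] and [s * b <= dotp w e], so the step [s *: e] stays feasible and lowers the
     squared distance by at least [s * dotp w e]. *)
  pose s := dotp w e / (dotp w e + b).
  have s0 : 0 < s by rewrite divr_gt0.
  have s1 : s <= 1 by rewrite ler_pdivrMr // mul1r lerDl.
  have sZ : lin_sys K1 K2 d (z + s *: e).
    split=> /= [i|]; last by rewrite mulmxDr -scalemxAr K2e0 scaler0 addr0.
    have := K1e i; have := K1z i.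
    rewrite !mulmxDr -scalemxAr !coordD coordZ.
    set A := (K1 *m z) i 0; set B := (K1 *m e) i 0 => h1 h2.
    have [B0|B0] := leP 0 B; last by rewrite (le_trans _ h1) // gerDl pmulr_rle0 // ltW.
    by rewrite (le_trans _ h2) // lerD2l ler_piMl.
  have := zmin _ sZ; rewrite opprD addrA -wdef.
  rewrite !(dotpDl, dotpDr, dotpNl, dotpNr, dotpZl, dotpZr) (dotpC e w) -/b.
  have sab : s * b <= dotp w e.
    by rewrite /s mulrAC ler_pdivrMr // ler_pM2l // lerDr ltW.
  rewrite -(@ler_pM2l _ s) // in sab.
  have : 0 < s * dotp w e by rewrite mulr_gt0.
  by move: sab; rewrite mulrN; move: (s * (s * b)) (s * dotp w e) => P Q; lra.
pose act i := (K1 *m z) i 0 == d.1 i 0.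
(* Left multiplication by [D] zeroes the inactive rows; their multipliers then vanish in
   [D *m u1]. *)
pose D : 'M[R]_p1 := diag_mx (\row_i (act i)%:R).
have DE (v : 'cV[R]_p1) i : (D *m v) i 0 = (act i)%:R * v i 0.
  by rewrite mul_diag_mx !mxE.
have [e K1e K2e|u1 [u2 [u10 wE]]] := @farkas _ _ _ _ (D *m K1) K2 w.
  pose sl i := d.1 i 0 - (K1 *m z) i 0.
  have sl0 i : 0 <= sl i by rewrite subr_ge0; apply: K1z.
  (* After scaling by [T^-1] the direction [e] respects the inactive constraints too; an active row
     adds nothing to the sum, since its slack is 0 and division by 0 gives 0. *)
  pose T := 1 + \sum_i `|(K1 *m e) i 0| / sl i.
  have T0 : 0 < T.
    by rewrite ltr_pwDl // sumr_ge0 // => i _; rewrite divr_ge0.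
  have : dotp w (T^-1 *: e) <= 0.
    apply: var; split=> /= [i|]; last first.
      by rewrite mulmxDr -scalemxAr K2e scaler0 addr0.
    rewrite mulmxDr -scalemxAr coordD coordZ.
    rewrite -lerBrDl -/(sl i) ler_pdivrMl //.
    have := K1e i; rewrite -mulmxA DE [leRHS]mxE /act.
    case: eqP => [e1|ne _].
      by rewrite mul1r /sl -e1 subrr mulr0.
    have sli : 0 < sl i.
      by rewrite lt0r sl0 andbT subr_eq0; apply/eqP => e1; apply: ne.
    rewrite -ler_pdivrMr // (@le_trans _ _ (`|(K1 *m e) i 0| / sl i)) //.
      by rewrite ler_wpM2r ?invr_ge0 ?sl0 // ler_norm.
    rewrite /T (bigD1 i) //= addrCA lerDl addr_ge0 // sumr_ge0 // => j _.
    by rewrite divr_ge0.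
  by rewrite dotpZr pmulr_rle0 // invr_gt0.
exists (D *m u1), u2; split.
- by move=> i; rewrite DE mxE mulr_ge0 //; have := u10 i; rewrite mxE.
- by move=> i lti; rewrite DE /act lt_eqF // mul0r.
- by rewrite wE trmx_mul tr_diag_mx mulmxA.
Qed.

Definition pos_l1norm p (x : 'cV[R]_p) : R := \sum_i Num.max (x i 0) 0.

Lemma pos_l1norm_ge0 p (x : 'cV[R]_p) : 0 <= pos_l1norm x.
Proof. by rewrite sumr_ge0 // => i _; rewrite le_max lexx orbT. Qed.

Lemma pos_l1norm_eq0 p (x : 'cV[R]_p) : lev x 0 -> pos_l1norm x = 0.
Proof.
move=> x0; apply: big1 => i _; apply/max_idPr.
by have := x0 i; rewrite mxE.
Qed.

Lemma pos_l1norm_le p (x : 'cV[R]_p) b :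
  (forall i, x i 0 <= b) -> pos_l1norm x <= p%:R * Num.max b 0.
Proof.
move=> xb; rewrite mulr_natl -[in leRHS](card_ord p) -sumr_const.
by apply: ler_sum => i _; rewrite ge_max !le_max xb lexx !orbT.
Qed.

Lemma pos_l1norm_col_mx p r (u : 'cV[R]_p) (v : 'cV[R]_r) :
  pos_l1norm (col_mx u v) = pos_l1norm u + pos_l1norm v.
Proof.
by rewrite /pos_l1norm big_split_ord; congr (_ + _); apply: eq_bigr => i _;
  rewrite ?col_mxEu ?col_mxEd.
Qed.

Lemma l1norm_col_mx p r (u : 'cV[R]_p) (v : 'cV[R]_r) :
  l1norm (col_mx u v) = l1norm u + l1norm v.
Proof.
by rewrite /l1norm big_split_ord; congr (_ + _); apply: eq_bigr => i _;
  rewrite ?col_mxEu ?col_mxEd.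
Qed.

Definition violation p1 p2 l (K1 : 'M[R]_(p1, l)) (K2 : 'M[R]_(p2, l))
    (d : 'cV[R]_p1 * 'cV[R]_p2) (x : 'cV[R]_l) : R :=
  pos_l1norm (K1 *m x - d.1) + l1norm (K2 *m x - d.2).

Lemma violation_ge0 p1 p2 l (K1 : 'M[R]_(p1, l)) (K2 : 'M[R]_(p2, l)) d x :
  0 <= violation K1 K2 d x.
Proof.
by rewrite addr_ge0 ?pos_l1norm_ge0 // sumr_ge0.
Qed.

Lemma robinson_sigma_ge0 m1 m2 l (K1 : 'M[R]_(m1, l)) (K2 : 'M[R]_(m2, l)) :
  0 <= robinson_sigma (@linfnorm R) (@l2norm R) K1 K2.
Proof. exact: bigmax_ge_id. Qed.

(* The displacement [x - z] to the projection is a conic combination of the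
   active rows; a bounded choice of its coefficients is what Robinson's
   constant provides, the set [S] being the inactive rows. *)
Lemma hoffman_robinson p1 p2 l (K1 : 'M[R]_(p1, l)) (K2 : 'M[R]_(p2, l)) d x :
  lin_sys K1 K2 d !=set0 ->
  exists2 z, lin_sys K1 K2 d z &
    l2norm (x - z) <=
    robinson_sigma (@linfnorm R) (@l2norm R) K1 K2 * violation K1 K2 d x.
Proof.
move=> /polyhedron_projection_normal-/(_ x)[z zZ [u1 [u2 [u1_ge0 u1_act wE]]]].
exists z => //; set w := x - z in wE *; set s := robinson_sigma _ _ _ _.
have s0 : 0 <= s := robinson_sigma_ge0 K1 K2.
have v0 := violation_ge0 K1 K2 d x.
have [w0|] := eqVneq (l2norm w) 0; first by rewrite w0 mulr_ge0.
move=> wN0; have w0 : 0 < l2norm w by rewrite lt0r wN0 l2norm_ge0.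
case: (zZ) => K1z K2z.
pose S := [set i | (K1 *m z) i 0 < d.1 i 0]%SET.
pose M1 := block_mx (rowsub (fun i : 'I_#|S| => enum_val i) 1%:M)
  (0 : 'M[R]_(#|S|, p2)) (- 1%:M : 'M[R]_p1) 0.
pose dd : 'cV[R]_(#|S| + p1) * 'cV[R]_l := (0, (l2norm w)^-1 *: w).
(* The two blocks of [M1] together make [a] nonnegative, and zero on the inactive rows [S]. *)
have M1E (a : 'cV[R]_p1) (b : 'cV[R]_p2) : lev (M1 *m col_mx a b) 0 <->
    lev 0 a /\ forall i, i \in S -> a i 0 <= 0.
  rewrite mul_block_col !mul0mx !addr0 mulNmx mul1mx.
  rewrite mul_rowsub_mx mul1mx; split.
    move=> /lev_col_mx0[h1 /lev_opp0 h2]; split=> // i iS; have := h1 (enum_rank_in iS i).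
    by rewrite !mxE enum_rankK_in.
  case=> a0 aS; apply/lev_col_mx0; split; last exact/lev_opp0.
  by move=> i; rewrite !mxE; apply: aS; apply: enum_valP.
(* Pairing the combination [u] of rows with [w] gives this bound: on an active row [K1 *m z] equals
   [d.1], so [K1 *m (x - z)] is the residual of [x] there. *)
have key u : lin_sys M1 (col_mx K1 K2)^T dd u ->
    l2norm w <= linfnorm u * violation K1 K2 d x.
  rewrite -[u]vsubmxK; move: (usubmx u) (dsubmx u) => a b {u} [/=].
  move=> /M1E[a0 aS]; rewrite tr_col_mx mul_row_col => abE.
  have -> : l2norm w = dotp w ((l2norm w)^-1 *: w).
    by rewrite dotpZr -l2norm_sqr expr2 mulKf.
  have coordl i : `|a i 0| <= linfnorm (col_mx a b).
    by have := ler_coord_linfnorm (col_mx a b) (lshift _ i); rewrite col_mxEu.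
  have coordr i : `|b i 0| <= linfnorm (col_mx a b).
    by have := ler_coord_linfnorm (col_mx a b) (rshift _ i); rewrite col_mxEd.
  rewrite -abE dotpDr !dotp_mulmx !trmxK !mulmxBr K2z mulrDr lerD //.
    rewrite dotpE /pos_l1norm mulr_sumr ler_sum // => i _.
    have ai0 : 0 <= a i 0 by have := a0 i; rewrite mxE.
    have [iS|iS] := boolP (i \in S).
      have -> : a i 0 = 0 by apply/eqP; rewrite eq_le ai0 aS.
      by rewrite mulr0 mulr_ge0 ?linfnorm_ge0 // le_max lexx orbT.
    have -> : (K1 *m x - K1 *m z) i 0 = (K1 *m x - d.1) i 0.
      rewrite !coordB.
      suff -> : (K1 *m z) i 0 = d.1 i 0 by [].
      by apply/eqP; rewrite eq_le K1z leNgt; move: iS; rewrite inE.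
    rewrite mulrC; apply: (@le_trans _ _ (a i 0 * Num.max ((K1 *m x - d.1) i 0) 0)).
      by rewrite ler_wpM2l // le_max lexx.
    rewrite ler_wpM2r ?le_max ?lexx ?orbT //.
    by rewrite (le_trans _ (coordl i)) // ler_norm.
  rewrite dotpE /l1norm mulr_sumr ler_sum // => i _.
  by rewrite (le_trans (ler_norm _)) // normrM mulrC ler_wpM2r.
have [u uS] : lin_sys M1 (col_mx K1 K2)^T dd !=set0.
  exists ((l2norm w)^-1 *: col_mx u1 u2); split=> /=; last first.
    by rewrite -scalemxAr tr_col_mx mul_row_col wE.
  rewrite scale_col_mx; apply/M1E; split=> i.
    by have := u1_ge0 i; rewrite !mxE => ?; rewrite mulr_ge0 // invr_ge0 ltW.
  by rewrite inE => /u1_act; rewrite mxE => ->; rewrite mulr0.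
have v_gt0 : 0 < violation K1 K2 d x.
  rewrite lt0r v0 andbT; apply: contraTneq (key u uS) => ->.
  by rewrite mulr0 -ltNge.
rewrite -ler_pdivrMr //; apply: le_trans (le_bigmax _ _ S).
apply: (@le_robinson_mu _ _ _ _ _ _ dd) => [||v vS]; first by exists u.
  by rewrite l2normE dotp_col_mx dotp0l add0r -l2normE l2normZ ger0_norm
    ?invr_ge0 ?l2norm_ge0 // mulVf.
by rewrite ler_pdivrMr // key.
Qed.

End Hoffman.

(** * Linear programming duality and the KKT system *)

Section LinearProgramming.
Variable R : realType.

Lemma lp_weak_duality p r (B : 'M[R]_(p, r)) b c x v :
  lev (B *m x) b -> lev 0 v -> B^T *m v = - c -> 0 <= dotp c x + dotp b v.
Proof.
move=> Bx v0 Bv; rewrite -[c]opprK -Bv dotpNl -dotp_mulmx (dotpC b) addrC subr_ge0.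
exact: dotp_lev.
Qed.

(** If primal feasibility, dual feasibility and a nonpositive gap were incompatible, [farkas_affine]
    would give a certificate. It is refuted by weak duality if the multiplier [s] of the gap is
    positive, and by the feasible points [x0], [v0] if [s = 0]. *)
Lemma lp_strong_duality p r (B : 'M[R]_(p, r)) b c :
  (exists x, lev (B *m x) b) -> (exists2 v, lev 0 v & B^T *m v = - c) ->
  exists x v, [/\ lev (B *m x) b, lev 0 v, B^T *m v = - c &
                  dotp c x + dotp b v = 0].
Proof.
move=> [x0 Bx0] [v0 v0_ge0 Bv0]; apply: contrapT => nosol.
pose N1 := col_mx (row_mx B 0) (col_mx (row_mx 0 (- 1%:M)) (row_mx c^T b^T)).
pose N2 := row_mx (0 : 'M[R]_(r, r)) B^T.
have [u|l [mu [l0]]] := @farkas_affine R _ _ _ N1 N2 (col_mx b (col_mx 0 0)) (- c).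
  rewrite -[u]vsubmxK; move: (usubmx u) (dsubmx u) => x v {u}.
  rewrite !mul_col_mx !mul_row_col !mul0mx !add0r addr0 mulNmx mul1mx.
  move=> /lev_col_mx[Bx /lev_col_mx[v_ge0 /(_ 0) cb]] Bv; apply: nosol.
  have v_ge0' : lev 0 v by apply/lev_opp0.
  exists x, v; split=> //; apply/eqP; rewrite eq_le (lp_weak_duality Bx) // andbT.
  by move: cb; rewrite coordD -/(dotp c x) -/(dotp b v) mxE.
move: l0; rewrite -[l]vsubmxK -[dsubmx l]vsubmxK.
move: (usubmx l) (usubmx (dsubmx l)) (dsubmx (dsubmx l)) => la nu s {l}.
move=> /lev0_col_mx[la0 /lev0_col_mx[nu0 /(_ 0)]].
rewrite [s]mx11_scalar !mxE eqxx mulr1n; move: (s 0 0) => {}s s0.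
rewrite !tr_col_mx !tr_row_mx !mul_row_col !mul_col_mx !trmxK !trmx0 !mul0mx.
rewrite linearN /= trmx1 mulNmx mul1mx !mul_mx_scalar !add_col_mx.
rewrite !dotp_col_mx !dotp0l !addr0 add0r => /eqP.
rewrite col_mx_eq0 => /andP[/eqP e1 /eqP e2].
rewrite add0r in e2.
rewrite dotpNl => lt0.
have e3 : nu = s *: b + B *m mu by move/eqP: e2; rewrite -addrA addrC subr_eq0 => /eqP.
have [s_gt0|] := ltP 0 s.
  have dualf : B^T *m (s^-1 *: la) = - c.
    rewrite -scalemxAr; move/eqP: e1; rewrite addr_eq0 => /eqP ->.
    by rewrite scalerN scalerA mulVf ?scale1r // gt_eqF.
  have primalf : lev (B *m (- (s^-1 *: mu))) b.
    move=> i; have := nu0 i; rewrite mxE e3 mulmxN -scalemxAr coordN coordD !coordZ.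
    by move=> h; rewrite lerNl ler_pdivlMl // mulrN; lra.
  have la0' : lev 0 (s^-1 *: la).
    by move=> i; have := la0 i; rewrite !mxE => h; rewrite mulr_ge0 // invr_ge0 ltW.
  have := lp_weak_duality primalf la0' dualf.
  rewrite dotpNr !dotpZr -mulrN -mulrDr pmulr_rge0 ?invr_gt0 //.
  by rewrite addrC leNgt lt0.
move=> s_le0; have {s0 s_le0} s0 : s = 0 by apply/eqP; rewrite eq_le s_le0 s0.
move: e1 e3; rewrite s0 !scale0r addr0 add0r => e1 e3.
have h1 : 0 <= dotp b la.
  have := dotp_lev la0 Bx0; rewrite dotp_mulmx e1 dotp0l.
  by rewrite dotpC.
have h2 : 0 <= dotp v0 (B *m mu) by rewrite -e3 dotp_ge0.
rewrite dotp_mulmx Bv0 dotpNl in h2.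
by move: lt0; lra.
Qed.

End LinearProgramming.

(** * The KKT system of the relaxed problem *)

Section Optimality.
Variables (R : realType) (m n q nh : nat).
Variables (A : 'M[R]_(m, n)) (M : 'M[R]_(m, q)) (y : 'cV[R]_m) (tau : R).
Variable Gamma : 'M[R]_(q, nh).

(** The blocks follow the block columns of [Mbar1]: [t] bounds [|x|], and [v1], [v2], [v3] are
    multipliers of [x <= t], [- x <= t] and the polytope constraints. *)
Definition kkt_point (x t v1 v2 : 'cV[R]_n) (v3 : 'cV[R]_nh) :=
  col_mx x (col_mx t (col_mx v1 (col_mx v2 v3))).

Lemma kkt_point_surj u : exists x t v1 v2 v3, u = kkt_point x t v1 v2 v3.
Proof.
exists (usubmx u), (usubmx (dsubmx u)), (usubmx (dsubmx (dsubmx u))).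
exists (usubmx (dsubmx (dsubmx (dsubmx u)))), (dsubmx (dsubmx (dsubmx (dsubmx u)))).
by rewrite /kkt_point !vsubmxK.
Qed.

(** [Grelax *m x <= brelax] is the polytope constraint [Gamma^T *m (M^T *m (A *m x - y)) <= tau]
    with the terms in [y] moved to the right. *)
Definition Grelax := (M *m Gamma)^T *m A.
Definition brelax : 'cV[R]_nh := tau *: const_mx 1 + (M *m Gamma)^T *m y.

Definition kkt_rhs :
    'cV[R]_(n + (n + (n + (nh + (n + (n + (n + nh))))))) * 'cV[R]_(n + 1) :=
  (col_mx 0 (col_mx 0 (col_mx (const_mx 1) (col_mx brelax
     (col_mx 0 (col_mx 0 (col_mx 0 0)))))), 0).

Lemma Mbar1_kkt_point x t v1 v2 v3 :
  Mbar1 A M Gamma *m kkt_point x t v1 v2 v3 =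
  col_mx (x - t) (col_mx (- x - t) (col_mx (v1 + v2) (col_mx (Grelax *m x)
    (col_mx (- t) (col_mx (- v1) (col_mx (- v2) (- v3))))))).
Proof.
rewrite /Mbar1 /row5 /kkt_point !mul_col_mx !mul_row_col !mul0mx !mulNmx !mul1mx.
by rewrite !addr0 !add0r.
Qed.

Lemma Mbar2_kkt_point x t v1 v2 v3 :
  Mbar2 A M y tau Gamma *m kkt_point x t v1 v2 v3 =
  col_mx (v1 - v2 + Grelax^T *m v3)
         ((\sum_i t i 0 + dotp brelax v3)%:M).
Proof.
rewrite /Mbar2 /row5 /kkt_point !mul_col_mx !mul_row_col !mul0mx !mulNmx !mul1mx.
rewrite !add0r; congr col_mx.
  by rewrite addrA /Grelax trmx_mul trmxK mulmxA.
rewrite [LHS]mx11_scalar coordD; congr (_ + _)%:M.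
  by rewrite mxE; apply: eq_bigr => i _; rewrite !mxE mul1r.
rewrite /dotp /brelax; congr ((_ *m _) 0 0).
by rewrite linearD linearZ /= trmx_const !trmx_mul !trmxK mulmxA.
Qed.

Definition kkt (x t v1 v2 : 'cV[R]_n) (v3 : 'cV[R]_nh) : Prop :=
  [/\ lev x t /\ lev (- x) t, lev (Grelax *m x) brelax,
      [/\ lev 0 v1, lev 0 v2, lev 0 v3 & lev (v1 + v2) (const_mx 1)],
      v1 - v2 + Grelax^T *m v3 = 0 & \sum_i t i 0 + dotp brelax v3 = 0].

Lemma lin_sys_kkt x t v1 v2 v3 :
  lin_sys (Mbar1 A M Gamma) (Mbar2 A M y tau Gamma) kkt_rhs
    (kkt_point x t v1 v2 v3) <-> lev 0 t /\ kkt x t v1 v2 v3.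
Proof.
rewrite /lin_sys /= Mbar1_kkt_point Mbar2_kkt_point; split.
  case=> /lev_col_mx[/lev_sub0 h1 /lev_col_mx[/lev_sub0 h2 /lev_col_mx[h3 /lev_col_mx[h4]]]].
  move=> /lev_col_mx[/lev_opp0 h5 /lev_col_mx[/lev_opp0 h6 /lev_col_mx[/lev_opp0 h7 /lev_opp0 h8]]].
  move=> /eqP; rewrite col_mx_eq0 => /andP[/eqP e1 /eqP/matrixP/(_ 0 0)].
  by rewrite !mxE mulr1n => e2.
case=> h5 [[h1 h2] h4 [h6 h7 h8 h3] e1 e2]; split.
  do ?[apply/lev_col_mx; split] => //; do ?[exact/lev_sub0]; exact/lev_opp0.
by apply/eqP; rewrite col_mx_eq0 e1 e2 raddf0 !eqxx.
Qed.

(** Strong duality for minimizing the sum of [t]. The multiplier [v4] of [0 <= t] is eliminated,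
    which turns its equation into [v1 + v2 <= 1]. *)
Lemma kkt_solvable :
  (exists x0, lev (Grelax *m x0) brelax) ->
  lin_sys (Mbar1 A M Gamma) (Mbar2 A M y tau Gamma) kkt_rhs !=set0.
Proof.
move=> [x0 Gx0].
pose I : 'M[R]_n := 1%:M.
pose B := col_mx (row_mx I (- I)) (col_mx (row_mx (- I) (- I))
  (col_mx (row_mx Grelax 0) (row_mx 0 (- I)))).
pose b := col_mx (0 : 'cV[R]_n) (col_mx (0 : 'cV[R]_n) (col_mx brelax (0 : 'cV[R]_n))).
pose c := col_mx (0 : 'cV[R]_n) (const_mx 1 : 'cV[R]_n).
have BE x t : B *m col_mx x t =
    col_mx (x - t) (col_mx (- x - t) (col_mx (Grelax *m x) (- t))).
  by rewrite !mul_col_mx !mul_row_col !mul0mx !mulNmx !mul1mx addr0 add0r.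
have BtE v1 v2 v3 v4 : B^T *m col_mx v1 (col_mx v2 (col_mx v3 v4)) =
    col_mx (v1 - v2 + Grelax^T *m v3) (- v1 - v2 - v4).
  rewrite !tr_col_mx !tr_row_mx !mul_row_col !mul_col_mx !add_col_mx !trmx0.
  by rewrite !linearN /= trmx1 !mul0mx !mulNmx !mul1mx addr0 add0r !addrA.
have BbE x t : lev (B *m col_mx x t) b <->
    [/\ lev x t, lev (- x) t, lev (Grelax *m x) brelax & lev 0 t].
  rewrite BE; split.
    by case/lev_col_mx => /lev_sub0 ? /lev_col_mx[/lev_sub0 ? /lev_col_mx[? /lev_opp0 ?]].
  case=> h1 h2 h3 h4; apply/lev_col_mx; split; first exact/lev_sub0.
  apply/lev_col_mx; split; first exact/lev_sub0.
  by apply/lev_col_mx; split => //; exact/lev_opp0.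
have [||u [v []]] := @lp_strong_duality R _ _ B b c.
- exists (col_mx x0 (\col_i `|x0 i 0|)); apply/BbE; split=> // i; rewrite !mxE //.
    exact: ler_norm.
  by rewrite -normrN ler_norm.
(* Dual feasible point: all the weight is on [0 <= t]. *)
- exists (col_mx 0 (col_mx 0 (col_mx 0 (const_mx 1)))).
    do 3![apply/lev0_col_mx; split => //].
    by move=> i; rewrite !mxE ler01.
  by rewrite BtE mulmx0 !oppr0 !addr0 add0r /c opp_col_mx oppr0.
rewrite -[u]vsubmxK; move: (usubmx u) (dsubmx u) => x t {u}.
rewrite -[v]vsubmxK -[dsubmx v]vsubmxK -[dsubmx (dsubmx v)]vsubmxK.
move: (usubmx v) (usubmx (dsubmx v)) => v1 v2.
move: (usubmx (dsubmx (dsubmx v))) (dsubmx (dsubmx (dsubmx v))) => v3 v4 {v}.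
move=> /BbE[h1 h2 h4 h5] v0; rewrite BtE /c opp_col_mx oppr0 => /eq_col_mx[e1 e3].
have [h6 [h7 [h8 h9]]] : lev 0 v1 /\ lev 0 v2 /\ lev 0 v3 /\ lev 0 v4.
  by case/lev0_col_mx: v0 => ? /lev0_col_mx[? /lev0_col_mx[]].
rewrite /b !dotp_col_mx !dotp0l !add0r addr0 => e2.
exists (kkt_point x t v1 v2 v3); apply/lin_sys_kkt; split=> //; split=> //.
- split=> // i; have := h9 i; move/matrixP/(_ i 0): e3; rewrite !mxE; lra.
- apply: etrans e2; congr (_ + _); rewrite dotpE; apply: eq_bigr => i _.
  by rewrite mxE mul1r.
Qed.

(** Weak duality: [l1norm x] is at most the sum of [t], which equals [- dotp brelax v3] and so is at
    most [dotp (v1 - v2) z]; the entries of [v1 - v2] lie in [-1, 1]. *)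
Lemma kkt_relaxation_optimal x t v1 v2 v3 z :
  kkt x t v1 v2 v3 -> lev (Grelax *m z) brelax -> l1norm x <= l1norm z.
Proof.
case=> [[xt xt'] Gx [v1_0 v2_0 v3_0 v12] e1 e2] Gz.
apply: (@le_trans _ _ (\sum_i t i 0)).
  apply: ler_sum => i _; rewrite ler_norml xt andbT.
  by have := xt' i; rewrite coordN lerNl.
have -> : \sum_i t i 0 = - dotp v3 brelax.
  by move/eqP: e2; rewrite addr_eq0 dotpC => /eqP.
apply: (@le_trans _ _ (dotp (v1 - v2) z)).
  move/eqP: e1; rewrite addr_eq0 => /eqP ->.
  by rewrite dotpNl -dotp_mulmx lerN2 dotp_lev.
rewrite dotpE; apply: ler_sum => i _; rewrite (le_trans (ler_norm _)) // normrM.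
rewrite ler_piMl // ler_norml.
by have := v1_0 i; have := v2_0 i; have := v12 i; rewrite !mxE; lra.
Qed.

End Optimality.

(** * Matrix conditions *)

Section LargestEntries.
Variables (R : realType) (n : nat).
Implicit Types (x u z : 'cV[R]_n) (S T : {set 'I_n}).

(** [T] maximizes the sum of [G] among sets of at most [k] indices, and [th] is the largest positive
    value left outside, or 0. Exchanging, removing or adding an index gives the inequalities; a set
    with fewer than [k] elements forces [th = 0]. *)
Lemma topk (G : 'I_n -> R) (k : nat) : exists T (th : R),
  [/\ (#|T| <= k)%N, 0 <= th, forall i, i \in T -> th <= G i,
      forall j, j \notin T -> G j <= th & #|T|%:R * th = k%:R * th].
Proof.
pose F T := \sum_(i in T) G i.
have F0 : (#|(finset.set0 : {set 'I_n})| <= k)%N by rewrite cards0.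
case: (@Order.TotalTheory.arg_maxP _ R _ finset.set0 (fun T => (#|T| <= k)%N) F F0) => T Tk Tmax'.
have Tmax S : (#|S| <= k)%N -> F S <= F T by exact: Tmax'.
pose th := \big[Num.max/0]_(j | j \notin T) G j.
have rem i : i \in T -> F T = G i + F (T :\ i)%SET.
  by move=> iT; rewrite /F (big_setD1 i).
have add T' j : j \notin T' -> F (j |: T')%SET = G j + F T'.
  by move=> jT; rewrite /F big_setU1.
have th0 : 0 <= th by exact: bigmax_ge_id.
exists T, th; split=> //.
- move=> i iT; apply/bigmax_leP; split=> [|j jT].
    have := Tmax (T :\ i)%SET; rewrite (leq_trans _ Tk) ?subset_leq_card ?subsetDl //.
    by move=> /(_ isT); rewrite (rem i iT) lerDr.
  have jTi : j \notin (T :\ i)%SET by rewrite !inE (negbTE jT) andbF.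
  have := Tmax (j |: T :\ i)%SET; rewrite cardsU1 jTi add1n.
  have -> : #|(T :\ i)%SET|.+1 = #|T| by rewrite [RHS](cardsD1 i) iT.
  by move=> /(_ Tk); rewrite add // (rem i iT) lerD2r.
- by move=> j jT; apply: le_bigmax_cond.
- move: Tk; rewrite leq_eqVlt => /predU1P[-> //|Tk].
  suff -> : th = 0 by rewrite !mulr0.
  apply/eqP; rewrite eq_le th0 andbT; apply/bigmax_leP; split=> // j jT.
  have := Tmax (j |: T)%SET; rewrite cardsU1 jT add1n => /(_ Tk).
  by rewrite add // gerDr.
Qed.

(** Fractional knapsack bound. After subtracting the threshold [th] from [G], the best weights are
    [al] on [T] and 0 outside, while the budget on the sum of the weights handles the remaining
    multiple of [th]. *)
Lemma topk_max (G : 'I_n -> R) (k : nat) T th :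
  0 <= th -> (forall i, i \in T -> th <= G i) ->
  (forall j, j \notin T -> G j <= th) -> #|T|%:R * th = k%:R * th ->
  forall (a : 'I_n -> R) (al : R), (forall i, 0 <= a i <= al) ->
    \sum_i a i <= k%:R * al -> \sum_i G i * a i <= al * \sum_(i in T) G i.
Proof.
move=> th0 thT thN Tk a al a01 suma.
have -> : \sum_i G i * a i = \sum_i (G i - th) * a i + th * \sum_i a i.
  by rewrite mulr_sumr -big_split /=; apply: eq_bigr => i _; ring.
have -> : al * (\sum_(i in T) G i) = \sum_(i in T) (G i - th) * al + th * (k%:R * al).
  rewrite -mulr_suml sumrB sumr_const -[th *+ _]mulr_natl Tk; ring.
apply: lerD; last by rewrite ler_wpM2l.
rewrite [leRHS]big_mkcond /=; apply: ler_sum => i _.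
have /andP[ai0 ai1] := a01 i.
case: ifPn => iT; first by rewrite ler_wpM2l // subr_ge0 thT.
by rewrite mulr_le0_ge0 // subr_le0 thN.
Qed.

Lemma l1norm_onC S x : l1norm x = l1norm_on S x + l1norm_on (~: S) x.
Proof.
rewrite /l1norm (bigID (mem S)) /=; congr (_ + _).
by apply: eq_bigl => i; rewrite inE.
Qed.

Lemma l1norm_on_ge0 S x : 0 <= l1norm_on S x.
Proof. by rewrite sumr_ge0. Qed.

Lemma l1norm_ge0 x : 0 <= l1norm x.
Proof. by rewrite sumr_ge0. Qed.

Lemma exists_largest_entries x (k : nat) : exists T,
  [/\ (#|T| <= k)%N,
      forall S, (#|S| <= k)%N -> l1norm_on S x <= l1norm_on T x &
      forall j, j \notin T -> k%:R * `|x j 0| <= l1norm_on T x].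
Proof.
have [T [th [Tk th0 thT thN e]]] := topk (fun i => `|x i 0|) k.
exists T; split=> // [S Sk|j jT].
  have := @topk_max _ k T th th0 thT thN e (fun i => (i \in S)%:R) 1.
  rewrite mul1r mulr1 => H; apply: le_trans (H _ _).
  - rewrite /l1norm_on big_mkcond /= ler_sum // => i _.
    by case: ifP; rewrite ?mulr1 ?mulr0.
  - by move=> i; case: (i \in S); rewrite /= ?lexx ler01.
  - rewrite (eq_bigr (fun i => if i \in S then 1 else 0)) => [|i _]; last by case: ifP.
    by rewrite -big_mkcond /= sumr_const ler_nat.
apply: (@le_trans _ _ (k%:R * th)); first by rewrite ler_wpM2l // thN.
by rewrite -e mulr_natl -sumr_const ler_sum.
Qed.

(** A sparse [u] cannot reduce [x] off its own support, and by maximality [T] leaves no more of the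
    l1 norm than that support does. *)
Lemma le_best_kterm_error x (k : nat) T :
  (forall S, (#|S| <= k)%N -> l1norm_on S x <= l1norm_on T x) ->
  l1norm_on (~: T) x <= best_kterm_error k x.
Proof.
move=> Tmax; apply: lb_le_inf.
  exists (l1norm (x - 0)), 0 => //=.
  by rewrite /l0norm (_ : [set _ | _]%SET = finset.set0) ?cards0 //; apply/setP => i;
     rewrite !inE mxE eqxx.
move=> _ [u /= uk <-].
set S := [set i | u i 0 != 0]%SET in uk.
apply: (@le_trans _ _ (l1norm_on (~: S) x)).
  have := Tmax S uk; have := l1norm_onC S x; rewrite (l1norm_onC T); lra.
rewrite [leRHS](l1norm_onC S) -[leLHS]add0r lerD ?l1norm_on_ge0 //.
apply: ler_sum => i; rewrite !inE negbK => /eqP ui.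
by rewrite coordB ui subr0.
Qed.

Lemma best_kterm_error_ge0 x (k : nat) : 0 <= best_kterm_error k x.
Proof.
have [T [_ Tmax _]] := exists_largest_entries x k.
exact: le_trans (l1norm_on_ge0 _ _) (le_best_kterm_error Tmax).
Qed.

(* Cai and Zhang's sparse representation of a polytope: otherwise a functional
   separates [v] from the vectors [u S], contradicting [topk_max]. *)
Lemma sparse_convex_decomposition (v : 'cV[R]_n) (k : nat) (al : R) :
  (forall i, `|v i 0| <= al) -> l1norm v <= k%:R * al ->
  exists (I : finType) (c : I -> R) (u : I -> 'cV[R]_n),
  [/\ forall s, 0 <= c s, \sum_s c s = 1, v = \sum_s c s *: u s &
      forall s, [/\ (l0norm (u s) <= k)%N, forall i, `|u s i 0| <= al &
                    forall i, v i 0 = 0 -> u s i 0 = 0]].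
Proof.
move=> v_al v_k.
pose ind S := (fun i => ((i \in S) && (#|S| <= k)%N)%:R : R).
(* Candidates: the sign pattern of [v] on [S], scaled by [al]; sets with more than [k] elements give
   0. *)
pose u S : 'cV[R]_n := \col_i (ind S i * (al * Num.sg (v i 0))).
(* The appended coordinate 1 turns the conic combination into a convex one. *)
have [x xS|c c0 cE] := @farkas_fin R _ _
    (fun S => col_mx (u S) 1%:M) (col_mx v 1%:M : 'cV[R]_(n + 1)).
  move: xS; rewrite -[x]vsubmxK; move: (usubmx x) (dsubmx x) => g g0 {x} xS.
  pose G i := Num.sg (v i 0) * g i 0.
  have [T [th [Tk th0 thT thN e]]] := topk G k.
  have := xS T; rewrite !dotp_col_mx; apply: le_trans; rewrite lerD2r.
  have -> : dotp v g = \sum_i G i * `|v i 0|.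
    by rewrite dotpE; apply: eq_bigr => i _; rewrite [v i 0 in LHS]numEsg /G; ring.
  have -> : dotp (u T) g = al * \sum_(i in T) G i.
    rewrite dotpE mulr_sumr [RHS]big_mkcond /=; apply: eq_bigr => i _.
    by rewrite mxE /ind Tk andbT /G; case: ifP => _; rewrite ?mul0r // mul1r mulrA.
  by apply: (topk_max th0 thT thN e) => // i; rewrite normr_ge0 v_al.
exists {set 'I_n}, c, u; move: cE.
rewrite (eq_bigr (fun S => col_mx (c S *: u S) (c S)%:M)); last first.
  by move=> S _; rewrite scale_col_mx scalemx1.
have -> : \sum_S col_mx (c S *: u S) (c S)%:M =
    col_mx (\sum_S c S *: u S) (\sum_S c S)%:M.
  rewrite raddf_sum; elim/big_rec3: _ => [|S a b d _ ->]; first by rewrite col_mx0.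
  by rewrite add_col_mx.
move=> /eq_col_mx[vE /matrixP/(_ 0 0)]; rewrite !mxE /= mulr1n => sumc.
split=> // S; split=> [|i|i vi0].
- have [Sk|Sk] := boolP (#|S| <= k)%N.
    apply: leq_trans Sk; apply: subset_leq_card; apply/fintype.subsetP => i.
    by rewrite inE mxE /ind; case: (i \in S) => //=; rewrite mul0r eqxx.
  rewrite /l0norm (_ : [set _ | _]%SET = finset.set0) ?cards0 //; apply/setP => i.
  by rewrite !inE mxE /ind (negbTE Sk) andbF mul0r eqxx.
- have al0 : 0 <= al := le_trans (normr_ge0 _) (v_al i).
  rewrite mxE !normrM normr_nat (ger0_norm al0) normr_sg.
  by case: (_ && _); case: (_ != _); rewrite /= ?mul0r ?mul1r ?mulr1 ?mulr0.
- by rewrite mxE vi0 sgr0 !mulr0.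
Qed.

End LargestEntries.

(** * From conditions (a)-(f) to a range space property *)

Section NullSpace.
Variables (R : realType) (m n : nat) (A : 'M[R]_(m, n)).

(** Common consequence of conditions (a) to (e); the non-strict inequality suffices to build the
    dual certificate. *)
Definition weak_NSP (k : nat) : Prop :=
  forall z : 'cV[R]_n, A *m z = 0 -> forall S : {set 'I_n}, (#|S| <= k)%N ->
    l1norm_on S z <= l1norm_on (~: S) z.

Lemma weak_NSP_max (z : 'cV[R]_n) (k : nat) (T : {set 'I_n}) :
  (forall S : {set 'I_n}, (#|S| <= k)%N -> l1norm_on S z <= l1norm_on T z) ->
  l1norm_on T z <= l1norm_on (~: T) z ->
  forall S : {set 'I_n}, (#|S| <= k)%N -> l1norm_on S z <= l1norm_on (~: S) z.
Proof.
move=> Tmax Tz S /Tmax; have := l1norm_onC S z; rewrite (l1norm_onC T); lra.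
Qed.

(** Pads a set to exactly [k] indices, the cardinality over which [coherence] takes its maximum. *)
Lemma exists_superset_card (S : {set 'I_n}) (k : nat) :
  (#|S| <= k <= n)%N -> exists T : {set 'I_n}, #|T| = k /\ S \subset T.
Proof.
move=> /andP[Sk kn].
have [d] := ubnP (k - #|S|); elim: d => // d IH in S Sk *; rewrite ltnS => led.
have [<-|ne] := eqVneq #|S| k; first by exists S.
have lt : (#|S| < k)%N by rewrite ltn_neqAle ne.
have [j jS|Sall] := pickP [pred j | j \notin S].
  have [||T [Tk ST]] := IH (j |: S)%SET; rewrite ?cardsU1 ?(negPf jS) ?jS ?add1n //.
    by move: led lt; clear; lia.
  by exists T; split=> //; apply: fintype.subset_trans ST; apply: finset.subsetUr.
have : #|S| = n.
  rewrite -[RHS]card_ord; apply: eq_card => i.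
  by have := Sall i; rewrite /= => /negbFE ->.
lia.
Qed.

Lemma sum_le_coherence i (S : {set 'I_n}) : i \notin S ->
  \sum_(j in S) `|dotp (col i A) (col j A)| <= coherence A #|S|.
Proof.
move=> iS; apply: le_trans (le_bigmax _ _ i).
by apply: (@le_bigmax_cond _ _ _ _ S); rewrite eqxx.
Qed.

(** Pairing [A *m z = 0] with the unit column [i] bounds [|z i 0|] by the other entries weighted by
    inner products. Summed over [S] with [#|S| = k], an entry in [S] meets [k - 1] columns and an
    entry outside meets [k]. *)
Lemma coherence_weak_NSP k : coherence_property A k -> weak_NSP k.
Proof.
case=> norm1 /andP[k1 kn] mu1 z Az S' S'k.
have kn' : (k <= n)%N by apply: leq_trans kn (leq_pred _).
suff H (S : {set 'I_n}) : #|S| = k -> l1norm_on S z <= l1norm_on (~: S) z.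
  have [|T [Tk TS]] := @exists_superset_card S' k; first by rewrite S'k.
  have := H T Tk; have := l1norm_onC S' z; rewrite (l1norm_onC T).
  have : l1norm_on S' z <= l1norm_on T z.
    by rewrite /l1norm_on [leRHS](big_setID S') /= (finset.setIidPr TS) lerDl sumr_ge0.
  lra.
move=> Sk.
have [c cE] : exists c : 'I_n -> 'I_n -> R,
    forall i j, `|dotp (col i A) (col j A)| = c i j.
  by exists (fun i j => `|dotp (col i A) (col j A)|).
have cC i j : c i j = c j i by rewrite -!cE dotpC.
have zi i : `|z i 0| <= \sum_(j | j != i) c i j * `|z j 0|.
  have : dotp (col i A) (A *m z) = 0 by rewrite Az dotp0r.
  have -> : A *m z = \sum_j z j 0 *: col j A.
    by apply/matrixP => a b; rewrite ord1 mxE summxE; apply: eq_bigr => j _;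
      rewrite !mxE mulrC.
  rewrite dotp_sumr (bigD1 i) //= dotpZr -l2norm_sqr norm1 expr1n mulr1.
  move/eqP; rewrite addr_eq0 => /eqP ->; rewrite normrN.
  apply: (le_trans (ler_norm_sum _ _ _)); apply: ler_sum => j _.
  by rewrite dotpZr normrM mulrC cE.
have bound : l1norm_on S z <= coherence A k.-1 * l1norm_on S z
                              + coherence A k * l1norm_on (~: S) z.
  apply: (@le_trans _ _ (\sum_(i in S) \sum_(j | j != i) c i j * `|z j 0|)).
    by apply: ler_sum => i _.
  rewrite (exchange_big_dep xpredT) //= (bigID (mem S)) /=; apply: lerD.
    rewrite mulr_sumr; apply: ler_sum => j jS.
    rewrite -mulr_suml ler_wpM2r //.
    have -> : k.-1 = #|(S :\ j)%SET| by rewrite -Sk (cardsD1 j) jS.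
    have := @sum_le_coherence j (S :\ j)%SET; rewrite !inE eqxx => /(_ isT).
    apply: le_trans; rewrite le_eqVlt; apply/orP; left; apply/eqP.
    apply: eq_big => [i|i _]; last by rewrite cE cC.
    by rewrite !inE andbC eq_sym.
  rewrite mulr_sumr [leRHS](eq_bigl (fun j => j \notin S)) => [|j]; last by rewrite inE.
  apply: ler_sum => j jS.
  rewrite -mulr_suml ler_wpM2r // -Sk.
  apply: le_trans (@sum_le_coherence j S jS).
  rewrite le_eqVlt; apply/orP; left; apply/eqP.
  apply: eq_big => [i|i _]; last by rewrite cE cC.
  by apply: andb_idr => iS; apply: contraNneq jS => ->.
have S0 := l1norm_on_ge0 S z; have C0 := l1norm_on_ge0 (~: S)%SET z.
have c0 : 0 <= coherence A k by exact: bigmax_ge_id.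
rewrite leNgt; apply/negP => lt.
have : coherence A k * l1norm_on (~: S) z <= coherence A k * l1norm_on S z.
  by rewrite ler_wpM2l // ltW.
have : (coherence A k + coherence A k.-1) * l1norm_on S z < 1 * l1norm_on S z.
  by rewrite ltr_pM2r // (le_lt_trans C0 lt).
rewrite mulrDl mul1r; lra.
Qed.

(** Subtract a quarter of the lower RIP bound for [h + mu *: u] from the upper one for
    [(2^-1 - mu) *: h - (mu / 2) *: u]: the terms in [dotp (A *m u) (A *m u)] cancel, and what
    remains of [dotp u u] is bounded by [dotp h h]. *)
Lemma RIP_quadratic_bound (h u : 'cV[R]_n) (k : nat) (d mu : R) :
  RIP A (2 * k) d -> (l0norm h <= k)%N -> (l0norm u <= k)%N ->
  dotp h u = 0 -> dotp u u <= dotp h h ->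
  (mu ^+ 2 - mu) * (dotp (A *m h) (A *m h) + dotp (A *m h) (A *m u)) <=
  (mu ^+ 2 - mu + d * (2^-1 - mu + 3 / 2 * mu ^+ 2)) * dotp h h.
Proof.
move=> [/andP[d0 d1] rip] hk uk hu uh.
have sparse a b : (l0norm (a *: h + b *: u)%R <= 2 * k)%N.
  have : (l0norm h + l0norm u <= 2 * k)%N by rewrite mul2n -addnn leq_add.
  apply: leq_trans; apply: leq_trans (leq_card_setU _ _).
  apply: subset_leq_card; apply/fintype.subsetP => i; rewrite !inE coordD !coordZ.
  apply: contraR; rewrite negb_or !negbK => /andP[/eqP -> /eqP ->].
  by rewrite !mulr0 addr0 eqxx.
have ex p (x z : 'cV[R]_p) a b : dotp (a *: x + b *: z) (a *: x + b *: z) =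
    a ^+ 2 * dotp x x + 2 * a * b * dotp x z + b ^+ 2 * dotp z z.
  by rewrite !(dotpDl, dotpDr, dotpZl, dotpZr) (dotpC z x); ring.
have /andP[_ ] := rip _ (sparse (2^-1 - mu) (- (mu / 2))).
have /andP[+ _] := rip _ (sparse 1 mu).
rewrite !l2norm_sqr !mulmxDr -!scalemxAr !ex hu.
move: (dotp (A *m h) (A *m h)) (dotp (A *m h) (A *m u)) (dotp (A *m u) (A *m u)).
move=> F H E.
have : 0 <= d * mu ^+ 2 * (dotp h h - dotp u u).
  apply: mulr_ge0; last by rewrite subr_ge0.
  by apply: mulr_ge0; [exact: ltW|exact: sqr_ge0].
move: (dotp h h) (dotp u u) => X U; lra.
Qed.

(* The constant [Num.sqrt 2 - 1] is Cai and Zhang's; it makes the coefficient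
   of [RIP_quadratic_bound] negative exactly when [d < 1 / Num.sqrt 2]. *)
Lemma RIP_weak_NSP (k : nat) (d : R) :
  (0 < k)%N -> RIP A (2 * k) d -> d < 1 / Num.sqrt 2 -> weak_NSP k.
Proof.
move=> k0 rip d2 h Ah.
have [T [Tk Tmax Tout]] := exists_largest_entries h k.
apply: (weak_NSP_max Tmax); rewrite leNgt; apply/negP => lt.
have kR : 0 < k%:R :> R by rewrite ltr0n.
pose hT : 'cV[R]_n := \col_i (if i \in T then h i 0 else 0).
pose v := h - hT.
have vE i : v i 0 = if i \in T then 0 else h i 0.
  by rewrite coordB mxE; case: ifP; rewrite ?subrr ?subr0.
(* [al] bounds the entries of the tail [v], by the choice of [T], and [k%:R * al] bounds its l1
   norm, by the assumption [lt] to be refuted. *)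
pose al := l1norm_on T h / k%:R.
have al0 : 0 <= al by rewrite divr_ge0 ?l1norm_on_ge0 // ltW.
have [i||I [c [u [c0 c1 vc uP]]]] := @sparse_convex_decomposition R n v k al.
- rewrite vE; case: ifPn => [_|/Tout]; first by rewrite normr0.
  by rewrite ler_pdivlMr // mulrC.
- rewrite /al mulrC divfK ?gt_eqF // ltW //; apply: le_lt_trans lt.
  rewrite /l1norm /l1norm_on [leRHS]big_mkcond /= ler_sum // => i _.
  by rewrite vE inE; case: ifP; rewrite ?normr0.
have hT_k : (l0norm hT <= k)%N.
  apply: leq_trans Tk; apply: subset_leq_card; apply/fintype.subsetP => i.
  by rewrite inE mxE; case: ifP; rewrite ?eqxx.
have hu s : dotp hT (u s) = 0.
  rewrite dotpE big1 // => i _; rewrite mxE; case: ifPn => iT; last by rewrite mul0r.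
  by case: (uP s) => _ _ ->; rewrite ?mulr0 // vE iT.
have N2 : l1norm_on T h ^+ 2 <= k%:R * dotp hT hT.
  pose b : 'cV[R]_n := \col_i (if i \in T then Num.sg (h i 0) else 0).
  have -> : l1norm_on T h = dotp b hT.
    rewrite dotpE /l1norm_on big_mkcond; apply: eq_bigr => i _ /=.
    by rewrite !mxE; case: ifP; rewrite ?mul0r // -normrEsg.
  have b_k : dotp b b <= k%:R.
    apply: (@le_trans _ _ #|T|%:R); last by rewrite ler_nat.
    rewrite dotpE -sumr_const [leRHS]big_mkcond /= ler_sum // => i _.
    rewrite !mxE; case: ifP => _; last by rewrite mul0r.
    by rewrite -expr2 sqr_sg; case: (_ != _); rewrite ?ler01.
  apply: (@le_trans _ _ ((l2norm b * l2norm hT) ^+ 2)).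
    rewrite ler_sqr ?nnegrE ?mulr_ge0 ?l2norm_ge0 ?dotp_le_l2norm //.
    rewrite dotpE sumr_ge0 // => i _; rewrite !mxE.
    by case: ifP; rewrite ?mul0r // -normrEsg.
  by rewrite exprMn !l2norm_sqr ler_wpM2r // dotp_diag_ge0.
have X0 : 0 < dotp hT hT.
  rewrite -(pmulr_rgt0 _ kR) (lt_le_trans _ N2) // exprn_gt0 //.
  exact: le_lt_trans (l1norm_on_ge0 _ _) lt.
(* At most [k] entries of size at most [al] give [k%:R * al ^+ 2], which [N2] bounds by the squared
   norm of the head [hT]. *)
have uu s : dotp (u s) (u s) <= dotp hT hT.
  have [us_k us_al us0] := uP s.
  apply: (@le_trans _ _ (k%:R * al ^+ 2)).
    apply: (@le_trans _ _ ((l0norm (u s))%:R * al ^+ 2)); last first.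
      by rewrite ler_wpM2r ?sqr_ge0 // ler_nat.
    rewrite mulr_natl -sumr_const [leRHS]big_mkcond dotpE ler_sum // => i _.
    rewrite inE; case: eqP => [->|_]; first by rewrite mul0r.
    by rewrite -expr2 -real_normK ?num_real // ler_sqr ?nnegrE ?us_al.
  rewrite -(ler_pM2l kR) mulrA -expr2 -exprMn.
  by rewrite [k%:R * al]mulrC divfK ?gt_eqF.
pose s2 : R := Num.sqrt 2; pose mu : R := s2 - 1.
pose kap := mu ^+ 2 - mu + d * (2^-1 - mu + 3 / 2 * mu ^+ 2).
have s2_gt0 : 0 < s2 by rewrite sqrtr_gt0.
have s2_sqr : s2 ^+ 2 = 2 by rewrite sqr_sqrtr.
(* Since [s2 ^+ 2 = 2], [kap] equals [(3 * s2 - 4) * (d * s2 - 1)]. *)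
have kap0 : kap < 0.
  have s2_43 : 0 < 3 * s2 - 4.
    rewrite subr_gt0 -(@ltr_pXn2r _ 2) ?nnegrE ?mulr_ge0 ?(ltW s2_gt0) //.
    rewrite exprMn s2_sqr; lra.
  have : d * s2 * (3 * s2 - 4) < 1 * (3 * s2 - 4).
    by rewrite ltr_pM2r // -ltr_pdivlMr.
  have -> : d * s2 * (3 * s2 - 4) = d * (3 * s2 ^+ 2 - 4 * s2) by ring.
  have -> : kap = (s2 ^+ 2 - 3 * s2 + 2) + d * (3 / 2 * s2 ^+ 2 - 4 * s2 + 3).
    by rewrite /kap /mu; field.
  rewrite s2_sqr; lra.
have Av : A *m v = - (A *m hT) by rewrite mulmxBr Ah sub0r.
(* Averaging over the decomposition replaces [u s] by [v], and [A *m v = - (A *m hT)] makes the left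
   side 0, whereas the right side is negative. *)
have : \sum_s c s * ((mu ^+ 2 - mu) * (dotp (A *m hT) (A *m hT)
         + dotp (A *m hT) (A *m u s))) <= \sum_s c s * (kap * dotp hT hT).
  apply: ler_sum => s _; rewrite ler_wpM2l //.
  by case: (uP s) => us_k _ _; apply: RIP_quadratic_bound rip _ _ _ _.
rewrite -mulr_suml c1 mul1r.
have -> : \sum_s c s * ((mu ^+ 2 - mu) * (dotp (A *m hT) (A *m hT)
         + dotp (A *m hT) (A *m u s))) = (mu ^+ 2 - mu) *
   ((\sum_s c s) * dotp (A *m hT) (A *m hT) + dotp (A *m hT) (A *m v)).
  rewrite vc mulmx_sumr dotp_sumr mulr_suml -big_split mulr_sumr /=.
  by apply: eq_bigr => s _; rewrite -scalemxAr dotpZr; ring.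
rewrite c1 Av dotpNr mul1r subrr mulr0 leNgt; apply/negP/negPn.
by rewrite nmulr_rlt0.
Qed.

Lemma stable_NSP_weak (k : nat) rho : stable_NSP A k rho -> weak_NSP k.
Proof.
move=> [/andP[_ r1] nsp] z Az S Sk.
have C0 := l1norm_on_ge0 (~: S)%SET z.
have [z0|zN0] := eqVneq z 0.
  rewrite /l1norm_on big1 ?sumr_ge0 // => i _.
  by rewrite z0 mxE normr0.
by rewrite (le_trans (nsp z zN0 Az S Sk)) // ler_piMl // ltW.
Qed.

Lemma robust_NSP_weak (k : nat) N rho1 rho2 :
  robust_NSP A k N rho1 rho2 -> weak_NSP k.
Proof.
case=> [[_ NZ _]] /andP[_ r1] _ nsp z Az S Sk.
rewrite (le_trans (nsp z S Sk)) // Az -(scale0r 0) NZ normr0 mul0r mulr0 addr0.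
by rewrite ler_piMl ?l1norm_on_ge0 // ltW.
Qed.

Lemma NSP_weak (k : nat) : NSP A k -> weak_NSP k.
Proof.
move=> nsp z Az S Sk; have [z0|zN0] := eqVneq z 0; last exact/ltW/nsp.
rewrite /l1norm_on big1 ?sumr_ge0 // => i _.
by rewrite z0 mxE normr0.
Qed.

(** Each of (a) to (f) leads to this form of the range space property, with the strict bound
    relaxed; it supplies the dual certificate. *)
Definition weak_RSP (k : nat) : Prop :=
  forall S1 S2 : {set 'I_n}, [disjoint S1 & S2]%B -> (#|S1| + #|S2| <= k)%N ->
  exists w : 'cV[R]_m,
    [/\ forall i, i \in S1 -> (A^T *m w) i 0 = 1,
        forall i, i \in S2 -> (A^T *m w) i 0 = -1 &
        forall i, `|(A^T *m w) i 0| <= 1].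

Lemma RSP_weak (k : nat) : RSP A k -> weak_RSP k.
Proof.
move=> rsp S1 S2 S12 Sk; have [zeta [w ->] [z1 z2 z3]] := rsp S1 S2 S12 Sk.
exists w; split=> // i.
have [iS1|iS1] := boolP (i \in S1); first by rewrite z1 // normr1.
have [iS2|iS2] := boolP (i \in S2); first by rewrite z2 // normrN1.
by rewrite ltW // z3 // inE negb_or iS1.
Qed.

(** If no [w] exists, the Farkas certificate gives a null vector [eta] of [A] with more l1 mass on
    [S] than off it. *)
Lemma weak_NSP_RSP (k : nat) : weak_NSP k -> weak_RSP k.
Proof.
move=> nsp S1 S2 S12 Sk; pose S := (S1 :|: S2)%SET.
have {}Sk : (#|S| <= k)%N := leq_trans (leq_card_setU _ _) Sk.
pose D : 'M[R]_n := diag_mx (\row_i (i \notin S)%:R).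
pose E : 'M[R]_n := diag_mx (\row_i (i \in S)%:R).
have DE (x : 'cV[R]_n) i : (D *m x) i 0 = (i \notin S)%:R * x i 0.
  by rewrite mul_diag_mx !mxE.
have EE (x : 'cV[R]_n) i : (E *m x) i 0 = (i \in S)%:R * x i 0.
  by rewrite mul_diag_mx !mxE.
pose sg : 'cV[R]_n := \col_i ((i \in S1)%:R - (i \in S2)%:R).
have sgS i : `|sg i 0| <= (i \in S)%:R.
  rewrite mxE inE; case: (i \in S1); case: (i \in S2);
  by rewrite /= ?subrr ?subr0 ?sub0r ?normrN ?normr1 ?normr0 ?ler01.
apply: contrapT => norsp.
have [w|l [s]] := @farkas_affine R _ _ _ (col_mx (D *m A^T) (- (D *m A^T)))
   (E *m A^T) (col_mx (const_mx 1) (const_mx 1)) sg.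
  rewrite mul_col_mx mulNmx -!mulmxA => /lev_col_mx[h1 h2] h3; apply: norsp.
  have h3' i : i \in S -> (A^T *m w) i 0 = sg i 0.
    by move=> iS; rewrite -h3 EE iS mul1r.
  exists w; split=> i.
  - move=> i1; rewrite h3' ?inE ?i1 // mxE i1.
    by rewrite (disjointFr S12 i1) subr0.
  - move=> i2; rewrite h3' ?inE ?i2 ?orbT // mxE i2.
    by rewrite (disjointFl S12 i2) sub0r.
  - have [iS|iS] := boolP (i \in S).
      by rewrite h3' // (le_trans (sgS i)) // lern1 leq_b1.
    have := h1 i; have := h2 i.
    by rewrite coordN !DE iS mul1r !mxE ler_norml lerNl => -> ->.
rewrite -[l]vsubmxK; move: (usubmx l) (dsubmx l) => a b {l}.
move=> [/lev0_col_mx[a0 b0]]; rewrite tr_col_mx mul_row_col linearN /=.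
rewrite !trmx_mul !trmxK !tr_diag_mx mulNmx -!mulmxA -mulmxBr -mulmxDr.
rewrite dotp_col_mx => Aeta lt0.
set eta := _ + _ in Aeta.
have := nsp eta Aeta S Sk; apply/negP; rewrite -ltNge.
have etaE i : eta i 0 = (i \notin S)%:R * (a i 0 - b i 0) + (i \in S)%:R * s i 0.
  by rewrite coordD coordB !DE EE mulrBr.
clearbody eta.
(* Off [S], [eta] is [a - b], so its mass there is at most the sum of [a] and [b]. The certificate
   makes this less than [- dotp sg s], and on [S] the vector [eta] is [s]. *)
apply: (@le_lt_trans _ _ (dotp (const_mx 1) a + dotp (const_mx 1) b)).
  rewrite /l1norm_on big_mkcond !dotpE -big_split ler_sum // => i _ /=.
  have := a0 i; have := b0 i; rewrite finset.in_setC !mxE !mul1r => bi ai.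
  case: ifPn => iS; last by rewrite addr_ge0.
  rewrite etaE iS (negbTE iS) mul1r mul0r addr0 (le_trans (ler_normB _ _)) //.
  by rewrite !ger0_norm.
apply: (@lt_le_trans _ _ (- dotp sg s)); first by rewrite -subr_lt0 opprK.
rewrite dotpE -sumrN /l1norm_on [leRHS]big_mkcond /= ler_sum // => i _.
have := sgS i; case: ifPn => iS /=.
  move=> sg1; rewrite etaE iS mul0r add0r mul1r (le_trans (ler_norm _)) //.
  by rewrite normrN normrM ler_piMl.
by rewrite normr_le0 => /eqP ->; rewrite mul0r oppr0.
Qed.

Lemma matrix_cond_weak_RSP (k : nat) :
  (1 <= k)%N ->
  [\/ coherence_property A k,
      exists2 d : R, RIP A (2 * k) d & d < 1 / Num.sqrt 2,
      exists rho : R, stable_NSP A k rho |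
      [\/ exists (N : 'cV[R]_m -> R) (rho1 rho2 : R), robust_NSP A k N rho1 rho2,
          NSP A k |
          RSP A k]] -> weak_RSP k.
Proof.
move=> k1 [/coherence_weak_NSP|[d rip d2]|[rho /stable_NSP_weak]|];
  try exact: weak_NSP_RSP.
  exact/weak_NSP_RSP/(RIP_weak_NSP k1 rip d2).
case=> [[N [rho1 [rho2 /robust_NSP_weak]]]|/NSP_weak|/RSP_weak //];
  exact: weak_NSP_RSP.
Qed.

End NullSpace.

(** * The constant c *)

Section SubmatrixConstant.
Variables (R : realType) (m n q : nat) (A : 'M[R]_(m, n)) (M : 'M[R]_(m, q)).

Lemma l1norm_le_norm_inf_1 p r (Q : 'M[R]_(p, r)) x :
  linfnorm x <= 1 -> l1norm (Q *m x) <= norm_inf_1 Q.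
Proof.
move=> x1; apply: ub_le_sup; last by exists x.
exists (\sum_(i < p) (\sum_i \sum_j `|Q i j|)) => _ [z /= z1 <-].
apply: ler_sum => i _; apply: le_trans (ler_coord_linfnorm _ _) _.
apply: le_trans (linfnorm_mulmx _ _) _; rewrite ler_piMr //.
by rewrite sumr_ge0 // => j _; rewrite sumr_ge0.
Qed.

(** The supremum in [cconst] runs over finitely many values: two proofs of [#|G| = m] give the same
    submatrix. *)
Lemma norm_inf_1_le_cconst (G : {set 'I_q}) (hG : #|G| = m) :
  colsubset M hG \in unitmx ->
  norm_inf_1 (invmx (colsubset M hG) *m invmx (A *m A^T) *m A) <= cconst A M.
Proof.
move=> MG; apply: ub_le_sup; last by exists G, hG.
pose v (G : {set 'I_q}) (hG : #|G| = m) :=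
  norm_inf_1 (invmx (colsubset M hG) *m invmx (A *m A^T) *m A).
have /choice[C HC] : forall G : {set 'I_q}, exists C, 0 <= C /\
    forall hG : #|G| = m, v G hG <= C.
  move=> G'; have [e|ne] := pselect (#|G'| = m); last by exists 0.
  exists `|v G' e|; split=> // hG'.
  by rewrite (eq_irrelevance hG' e) ler_norm.
exists (\sum_G C G) => _ [G' [hG' [_ ->]]].
rewrite (le_trans ((HC G').2 hG')) // (bigD1 G') //= lerDl sumr_ge0 // => j _.
by case: (HC j).
Qed.

Lemma gram_unitmx : \rank A = m -> A *m A^T \in unitmx.
Proof.
move=> rA; rewrite -row_free_unit; apply/inj_row_free => v vA.
have fA : row_free A by apply/eqP.
apply/eqP; rewrite -(mulmx_free_eq0 v fA); apply/eqP/trmx_inj.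
rewrite trmx0; apply: dotp_diag_eq0.
by rewrite /dotp trmxK trmx_mul -mulmxA (mulmxA A) (mulmxA v) vA mul0mx mxE.
Qed.

(** [fullrankfun] selects [m] independent rows of [M^T] in some order, [colsubset] the same ones in
    increasing order; comparing row spaces avoids the permutation. *)
Lemma exists_colsubset_unitmx : \rank M = m ->
  exists (G : {set 'I_q}) (hG : #|G| = m), colsubset M hG \in unitmx.
Proof.
move=> rM; have fM : row_full M^T by rewrite /row_full mxrank_tr rM.
pose f := fullrankfun fM.
pose G := [set f i | i in 'I_m]%SET.
have hG : #|G| = m by rewrite card_imset ?card_ord //; exact: fullrankfun_inj.
exists G, hG; rewrite -unitmx_tr -row_full_unit -sub1mx.
have -> : (colsubset M hG)^T =
    rowsub (fun i : 'I_m => enum_val (cast_ord (esym hG) i)) M^T.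
  by apply/matrixP => i j; rewrite !mxE.
have : (1%:M <= rowsub f M^T)%MS by rewrite sub1mx row_full_unit fullrowsub_unit.
move=> /submx_trans; apply; apply/row_subP => i.
have fiG : f i \in G by rewrite imset_f.
have -> : row i (rowsub f M^T) =
    row (cast_ord hG (enum_rank_in fiG (f i)))
      (rowsub (fun i : 'I_m => enum_val (cast_ord (esym hG) i)) M^T).
  apply/matrixP => a b; rewrite !mxE cast_ord_comp cast_ord_id.
  by rewrite enum_rankK_in.
exact: row_sub.
Qed.

(** Extend [u], the solution on the columns [G], by zeros. Since [w] is [(A *m A^T)^-1 *m A] applied
    to [A^T *m w], [u] is a matrix from the definition of [cconst] applied to a vector with entries
    in [-1, 1]. *)
Lemma exists_preimage_l1norm : \rank A = m -> \rank M = m ->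
  forall w : 'cV[R]_m, (forall i, `|(A^T *m w) i 0| <= 1) ->
  exists2 h : 'cV[R]_q, M *m h = w & l1norm h <= cconst A M.
Proof.
move=> rA rM w w1; have [G [hG MG]] := exists_colsubset_unitmx rM.
pose g (i : 'I_m) := enum_val (cast_ord (esym hG) i).
pose u := invmx (colsubset M hG) *m w.
exists (colsub g 1%:M *m u).
  have -> : M *m (colsub g 1%:M *m u) = colsubset M hG *m u.
    rewrite mulmxA; congr (_ *m _).
    by rewrite mulmx_colsub mulmx1.
  by rewrite /u mulKVmx.
apply: (@le_trans _ _ (l1norm u)).
  apply: (@le_trans _ _ (\sum_a \sum_j (g j == a)%:R * `|u j 0|)).
    apply: ler_sum => a _; rewrite mxE (le_trans (ler_norm_sum _ _ _)) //.
    by apply: ler_sum => j _; rewrite !mxE normrM normr_nat eq_sym.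
  rewrite exchange_big; apply: ler_sum => j _ /=.
  rewrite -mulr_suml (bigD1 (g j)) //= eqxx big1 ?addr0 ?mul1r // => a.
  by rewrite eq_sym => /negbTE ->.
apply: le_trans (norm_inf_1_le_cconst MG).
have -> : u = invmx (colsubset M hG) *m invmx (A *m A^T) *m A *m (A^T *m w).
  by rewrite -!mulmxA (mulmxA A) mulKmx // gram_unitmx.
by apply: l1norm_le_norm_inf_1; apply: linfnorm_le.
Qed.

(** Interpolating the value 1 at one index gives [w != 0], hence a nonzero [h] whose l1 norm is at
    most [cconst A M]. *)
Lemma cconst_gt0 k : (0 < k)%N -> (0 < n)%N -> \rank A = m -> \rank M = m ->
  weak_RSP A k -> 0 < cconst A M.
Proof.
move=> k0 n0 rA rM rsp; pose i := Ordinal n0.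
have [||w [w1 _ wn]] := rsp [set i]%SET finset.set0.
- by rewrite -setI_eq0 finset.setI0.
- by rewrite cards1 cards0 addn0.
have [h hw hc] := exists_preimage_l1norm rA rM wn.
apply: lt_le_trans hc; rewrite lt0r l1norm_ge0 andbT; apply/eqP => h0.
have hz : h = 0.
  apply/matrixP => a b; rewrite ord1 mxE.
  move/eqP: h0; rewrite psumr_eq0 // => /allP/(_ a (mem_index_enum a)).
  by rewrite normr_eq0 => /eqP.
have := w1 i; rewrite inE eqxx -hw hz !mulmx0 mxE => /(_ isT)/esym/eqP.
by rewrite oner_eq0.
Qed.

End SubmatrixConstant.

(** * Error bound for the relaxed problem *)

Section Norms.
Variables (R : realType) (q : nat) (phi : 'cV[R]_q -> R).
Hypothesis phi_norm : is_norm phi.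

Lemma is_norm0 : phi 0 = 0.
Proof. by case: phi_norm => _ phiZ _; rewrite -(scale0r 0) phiZ normr0 mul0r. Qed.

Lemma is_normN z : phi (- z) = phi z.
Proof. by case: phi_norm => _ phiZ _; rewrite -scaleN1r phiZ normrN1 mul1r. Qed.

Lemma is_norm_ge0 z : 0 <= phi z.
Proof.
case: phi_norm => _ _ /(_ z (- z)); rewrite subrr is_norm0 is_normN; lra.
Qed.

Lemma dotp_le_norm a z : dual_norm phi a = 1 -> dotp a z <= phi z.
Proof.
move=> a1; have [phi0 phiZ _] := phi_norm.
have [/phi0 ->|zN0] := eqVneq (phi z) 0; first by rewrite dotp0r is_norm0.
have z0 : 0 < phi z by rewrite lt0r zN0 is_norm_ge0.
(* A set without a supremum would get the default value 0, against [dual_norm phi a = 1]. *)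
have ub : has_sup [set dotp a x | x in [set x | phi x <= 1]].
  apply: contrapT => /sup_out; rewrite -/(dual_norm phi a) a1 => /eqP.
  by rewrite oner_eq0.
have : dotp a ((phi z)^-1 *: z) <= dual_norm phi a.
  apply: (ub_le_sup ub.2); exists ((phi z)^-1 *: z) => //=.
  by rewrite phiZ ger0_norm ?mulVf // invr_ge0 ltW.
by rewrite a1 dotpZr mulrC ler_pdivrMr // mul1r.
Qed.

End Norms.

Section Stability.
Variables (R : realType) (m n q nh : nat).
Variables (A : 'M[R]_(m, n)) (M : 'M[R]_(m, q)) (y : 'cV[R]_m) (tau : R).
Variables (Gamma : 'M[R]_(q, nh)) (phi : 'cV[R]_q -> R).
Hypothesis rankA : \rank A = m.
Hypothesis rankM : \rank M = m.
Hypothesis tau_gt0 : 0 < tau.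
Hypothesis phi_norm : is_norm phi.
Hypothesis col_le_phi : forall j z, dotp (col j Gamma) z <= phi z.
Hypothesis colP : forall i, exists j, col j Gamma = unitvec R i.
Hypothesis colN : forall i, exists j, col j Gamma = - unitvec R i.

Local Notation G := (Grelax A M Gamma).
Local Notation b := (brelax M y tau Gamma).
Local Notation res := (residual A M y).
Local Notation c := (cconst A M).
Local Notation gam := (gammabar A M y tau Gamma).
Local Notation K1 := (Mbar1 A M Gamma).
Local Notation K2 := (Mbar2 A M y tau Gamma).
Local Notation rhs := (kkt_rhs n M y tau Gamma).

Lemma relaxed_constraintE x j :
  (G *m x - b) j 0 = dotp (col j Gamma) (res x) - tau.
Proof.
have -> : G *m x - b = Gamma^T *m res x - tau *: const_mx 1.
  rewrite /Grelax /brelax /residual !mulmxBr !trmx_mul !mulmxA.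
  by rewrite opprD addrA addrAC.
rewrite coordB coordZ [const_mx 1 j 0]mxE mulr1; congr (_ - _).
by rewrite mulmx_coord -tr_col trmxK.
Qed.

Lemma lev_relaxed x :
  lev (G *m x) b <-> forall j, dotp (col j Gamma) (res x) <= tau.
Proof.
split=> [Gx j|Gx j]; last by rewrite -subr_le0 -coordB relaxed_constraintE subr_le0.
by rewrite -subr_le0 -relaxed_constraintE coordB subr_le0.
Qed.

Lemma feasible_relaxed x : feasible A M y tau phi x -> lev (G *m x) b.
Proof. by move=> fx; apply/lev_relaxed => j; apply: le_trans (col_le_phi _ _) fx. Qed.

Lemma exists_feasible : exists x, feasible A M y tau phi x.
Proof.
(* This point solves [A *m x = y], so its residual is 0. *)
exists (A^T *m (invmx (A *m A^T) *m y)); rewrite /feasible /residual.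
by rewrite mulmxA mulKVmx ?gram_unitmx // subrr mulmx0 is_norm0 // ltW.
Qed.

Lemma kkt_lin_sys_neq0 : lin_sys K1 K2 rhs !=set0.
Proof.
apply: kkt_solvable; have [x fx] := exists_feasible.
by exists x; apply: feasible_relaxed.
Qed.

(** If the constant were 0, Hoffman's bound would make every point a solution of the KKT system; a
    point with [t = -1] is not. *)
Lemma gammabar_gt0 : (0 < n)%N -> 0 < gam.
Proof.
move=> n0; rewrite lt0r robinson_sigma_ge0 andbT; apply/eqP => g0.
pose u0 : 'cV[R]_(n + (n + (n + (n + nh)))) :=
  kkt_point 0 (- const_mx 1) 0 0 0.
have [z zZ] := hoffman_robinson u0 kkt_lin_sys_neq0.
rewrite -/gam g0 mul0r => u0z.
have u0zE : u0 = z.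
  apply/eqP; rewrite -subr_eq0; apply/eqP/dotp_diag_eq0; rewrite -l2norm_sqr.
  have -> : l2norm (u0 - z) = 0 by apply/eqP; rewrite eq_le u0z l2norm_ge0.
  by rewrite expr0n.
move: zZ; rewrite -u0zE => /lin_sys_kkt[/(_ (Ordinal n0)) + _].
by rewrite !mxE lerNr oppr0 ler10.
Qed.

Lemma coord_le_phi (z : 'cV[R]_q) i : `|z i 0| <= phi z.
Proof.
have [j jE] := colP i; have [j' jE'] := colN i.
have := col_le_phi j z; have := col_le_phi j' z.
by rewrite jE jE' dotpNl dotp_unitvec ler_norml lerNl => -> ->.
Qed.

Lemma vec_sum_unitvec p (v : 'cV[R]_p) : v = \sum_i v i 0 *: unitvec R i.
Proof.
apply/matrixP => a d; rewrite ord1 summxE (bigD1 a) //= !mxE !eqxx mulr1.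
by rewrite big1 ?addr0 // => j ja; rewrite !mxE eq_sym (negbTE ja) mulr0.
Qed.

Lemma exists_multiplier (h : 'cV[R]_q) :
  exists2 v : 'cV[R]_nh, lev 0 v &
    Gamma *m v = - h /\ dotp (const_mx 1) v = l1norm h.
Proof.
have [cp cpE] := choice colP; have [cn cnE] := choice colN.
(* The weight [|h i 0|] goes to the column of sign opposite to [h i 0], which produces [- h]. *)
pose idx i := if 0 <= h i 0 then cn i else cp i.
exists (\sum_i `|h i 0| *: unitvec R (idx i)).
  move=> j; rewrite mxE summxE sumr_ge0 // => i _.
  by rewrite !mxE mulr_ge0 // ler0n.
split.
  rewrite mulmx_sumr [h in RHS]vec_sum_unitvec -sumrN; apply: eq_bigr => i _.
  rewrite -scalemxAr /unitvec -colE /idx -scaleNr.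
  case: ifPn => [h0|]; first by rewrite cnE scalerN scaleNr ger0_norm.
  by rewrite -ltNge => h0; rewrite cpE ltr0_norm.
rewrite dotp_sumr; apply: eq_bigr => i _.
by rewrite dotpZr dotpC dotp_unitvec mxE mulr1.
Qed.

(** On the largest entries [T] the certificate has the sign of [x] (1 at a zero entry) and the gap
    vanishes; any other entry contributes at most [2 * |x i 0|]. *)
Lemma weak_RSP_certificate k x : weak_RSP A k ->
  exists2 w, forall i, `|(A^T *m w) i 0| <= 1 &
    0 <= l1norm x - dotp x (A^T *m w) <= 2 * best_kterm_error k x.
Proof.
move=> rsp; have [T [Tk Tmax _]] := exists_largest_entries x k.
pose B := [set i | 0 <= x i 0]%SET.
have [||w [w1 w2 wn]] := rsp (T :&: B)%SET (T :\: B)%SET.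
- rewrite -setI_eq0; apply/eqP/setP => i; rewrite !inE.
  by case: (0 <= x i 0); rewrite !(andbT, andbF, andFb).
- by rewrite cardsID.
exists w => //; rewrite dotpE /l1norm -sumrB; apply/andP; split.
  apply: sumr_ge0 => i _; rewrite subr_ge0 (le_trans (ler_norm _)) // normrM.
  by rewrite ler_piMr.
apply: (@le_trans _ _ (2 * l1norm_on (~: T) x)); last first.
  by rewrite ler_wpM2l // le_best_kterm_error.
rewrite mulr_sumr [leRHS]big_mkcond /=; apply: ler_sum => i _.
rewrite finset.in_setC; case: (boolP (i \in T)) => iT /=.
  have [x0|x0] := leP 0 (x i 0).
    by rewrite w1 ?inE ?iT //= mulr1 ger0_norm // subrr.
  by rewrite w2 ?inE ?iT -?ltNge ?andbT // mulrN1 opprK ltr0_norm // addNr.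
rewrite (mulr_natl _ 2) mulr2n lerD2l -mulrN (le_trans (ler_norm _)) // normrM normrN.
by rewrite ler_piMr.
Qed.

Lemma exists_small_violation k x : weak_RSP A k -> exists t v1 v2 v3,
  violation K1 K2 rhs (kkt_point x t v1 v2 v3) <=
  nh%:R * Num.max (phi (res x) - tau) 0 + 2 * best_kterm_error k x
  + c * tau + c * phi (res x).
Proof.
move=> /(@weak_RSP_certificate k x)[w w1 /andP[xw0 xw]].
have [h hw hc] := exists_preimage_l1norm rankA rankM w1.
have [v3 v30 [Gv3 sv3]] := exists_multiplier h.
have [zeta zetaE] : exists zeta, zeta = A^T *m w by exists (A^T *m w).
rewrite -zetaE in w1 xw0 xw.
pose t : 'cV[R]_n := \col_i `|x i 0|.
pose v1 : 'cV[R]_n := \col_i Num.max (zeta i 0) 0.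
pose v2 : 'cV[R]_n := \col_i Num.max (- zeta i 0) 0.
exists t, v1, v2, v3.
have v12 : v1 - v2 = zeta.
  by apply/matrixP => i j; rewrite ord1 !mxE !maxEle; do 2!case: ifP; lra.
have v1pv2 : lev (v1 + v2) (const_mx 1).
  move=> i; have := w1 i; rewrite !mxE ler_norml !maxEle => /andP[].
  by do 2!case: ifP; lra.
rewrite /violation /= Mbar1_kkt_point Mbar2_kkt_point subr0 !opp_col_mx !add_col_mx.
rewrite !subr0 !pos_l1norm_col_mx l1norm_col_mx.
have posN p (z : 'cV[R]_p) : lev 0 z -> pos_l1norm (- z) = 0.
  by move=> z0; apply: pos_l1norm_eq0; apply/lev_opp0.
have posB p (z z' : 'cV[R]_p) : lev z z' -> pos_l1norm (z - z') = 0.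
  by move=> z0; apply: pos_l1norm_eq0; apply/lev_sub0.
rewrite (posB _ x t) => [|i]; last by rewrite mxE ler_norm.
rewrite (posB _ (- x) t) => [|i]; last by rewrite !mxE -normrN ler_norm.
rewrite (posB _ _ _ v1pv2) (posN _ v3) //.
rewrite (posN _ t) => [|i]; last by rewrite !mxE.
rewrite (posN _ v1) => [|i]; last by rewrite !mxE le_max lexx orbT.
rewrite (posN _ v2) => [|i]; last by rewrite !mxE le_max lexx orbT.
have GTv3 : G^T *m v3 = - zeta.
  by rewrite zetaE /Grelax trmx_mul trmxK -!mulmxA Gv3 !mulmxN hw.
have -> : v1 - v2 + G^T *m v3 = 0 by rewrite v12 GTv3 subrr.
have -> : l1norm (0 : 'cV[R]_n) = 0.
  by rewrite /l1norm big1 // => i _; rewrite mxE normr0.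
(* With [l1norm x] added, the duality gap is the certificate gap plus [tau * l1norm h] plus
   [dotp (res x) h], whose bounds are the terms in [best_kterm_error], [c * tau] and
   [c * phi (res x)]. *)
have bv3 : dotp b v3 = tau * l1norm h - dotp x zeta + dotp (res x) h.
  rewrite /brelax dotpDl dotpZl sv3 -addrA; congr (_ + _).
  rewrite -dotp_mulmx -mulmxA Gv3 mulmxN hw dotpNr /residual -dotp_mulmx hw.
  by rewrite zetaE (dotp_mulmx A^T) trmxK dotpDl dotpNl; ring.
have st : \sum_i t i 0 = l1norm x by apply: eq_bigr => i _; rewrite mxE.
have rh : `|dotp (res x) h| <= c * phi (res x).
  apply: (@le_trans _ _ (phi (res x) * l1norm h)).
    rewrite dotpE mulr_sumr (le_trans (ler_norm_sum _ _ _)) // ler_sum // => i _.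
    by rewrite normrM ler_wpM2r // coord_le_phi.
  by rewrite mulrC ler_wpM2r // is_norm_ge0.
have tauh : 0 <= tau * l1norm h <= c * tau.
  by rewrite mulr_ge0 ?l1norm_ge0 ?(ltW tau_gt0) //= mulrC ler_pM2r.
have Gb : pos_l1norm (G *m x - b) <= nh%:R * Num.max (phi (res x) - tau) 0.
  by apply: pos_l1norm_le => j; rewrite relaxed_constraintE lerD2r.
have l1E : l1norm ((\sum_i t i 0 + dotp b v3)%:M : 'cV[R]_1) =
    `|\sum_i t i 0 + dotp b v3|.
  by rewrite /l1norm big_ord1 mxE mulr1n.
rewrite l1E st bv3.
have : `|l1norm x + (tau * l1norm h - dotp x zeta + dotp (res x) h)| <=
    2 * best_kterm_error k x + c * tau + c * phi (res x).
  move: rh tauh; rewrite !ler_norml => /andP[rh1 rh2] /andP[h1 h2].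
  by apply/andP; split; lra.
lra.
Qed.

Lemma exists_close_relaxed_optimum k x :
  (0 < n)%N -> weak_RSP A k -> exists xr,
  [/\ lev (G *m xr) b, forall z, lev (G *m z) b -> l1norm xr <= l1norm z &
      l2norm (x - xr) <= gam * (nh%:R * Num.max (phi (res x) - tau) 0
        + 2 * best_kterm_error k x + c * tau + c * phi (res x))].
Proof.
move=> n0 rsp; have [t [v1 [v2 [v3 viol]]]] := exists_small_violation x rsp.
have [z zZ] := hoffman_robinson (kkt_point x t v1 v2 v3) kkt_lin_sys_neq0.
have [xr [t' [v1' [v2' [v3' zE]]]]] := kkt_point_surj z.
move: zZ; rewrite zE => /lin_sys_kkt[_ kktr] close.
exists xr; split; first by case: kktr.
  by move=> z'; apply: kkt_relaxation_optimal kktr.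
apply: le_trans (le_trans close _); last by rewrite ler_wpM2l // robinson_sigma_ge0.
(* Dropping the blocks other than [x] does not increase the Euclidean norm. *)
rewrite /kkt_point opp_col_mx add_col_mx !l2normE dotp_col_mx ler_wsqrtr //.
by rewrite lerDl dotp_diag_ge0.
Qed.

End Stability.

(** * From the relaxed problem back to (P) *)

Lemma hausdorff_dist_close (R : realType) p (O1 O2 : set 'cV[R]_p) (d e : R) z :
  (hausdorff_dist O1 O2 <= d%:E)%E -> 0 < e -> O2 z ->
  exists2 u, O1 u & l2norm (u - z) <= d + e.
Proof.
rewrite /hausdorff_dist ge_max => /andP[_ supd] e0 O2z.
have [|_ [u O1u <-]] := @ereal_inf_lt _ [set (l2norm (u - z))%:E | u in O1] (d + e)%:E.
  apply: (@le_lt_trans _ _ d%:E); last by rewrite lte_fin ltrDl.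
  by apply: le_trans supd; apply: ereal_sup_ubound; exists z.
by rewrite lte_fin => /ltW; exists u.
Qed.

Lemma dotp_Qnormals_le_norm (R : realType) q (phi : 'cV[R]_q -> R) P eps j :
  is_norm phi -> (forall i, dual_norm phi (unitvec R i) = 1) ->
  forall a z, Qnormals phi P eps j a -> dotp a z <= phi z.
Proof.
move=> phi_norm dual1 a z [[k _ [_ a1]]|[i [->|->]]]; try exact: dotp_le_norm.
by rewrite dotpNl -dotpNr -(is_normN phi_norm z) dotp_le_norm.
Qed.

Lemma Qpoly_normals (R : realType) q (phi : 'cV[R]_q -> R) P eps j z :
  (forall a, Qnormals phi P eps j a -> dotp a z <= 1) ->
  Qpoly phi P eps j z.
Proof.
move=> Qz k kj; split=> [a aP|i]; first by apply: Qz; left; exists k.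
by split; apply: Qz; right; exists i; [left|right].
Qed.

Lemma Sstar_optimal (R : realType) m n q (A : 'M[R]_(m, n)) (M : 'M[R]_(m, q))
    y tau phi x :
  Sstar A M y tau phi x -> optimal A M y tau phi x.
Proof.
case=> xo fx; split=> // z fz; apply: le_trans xo _.
apply: ge_inf; last by exists z.
by exists 0 => _ [u _ <-]; exact: l1norm_ge0.
Qed.

Theorem corollary4p6 (R : realType) (m n q : nat)
  (A : 'M[R]_(m, n)) (M : 'M[R]_(m, q)) (y : 'cV[R]_m) (tau : R)
  (phi : 'cV[R]_q -> R)
  (m_gt0 : (0 < m)%N) (m_lt_n : (m < n)%N) (m_le_q : (m <= q)%N)
  (rankA : \rank A = m) (rankM : \rank M = m)
  (tau_gt0 : 0 < tau)
  (phi_norm : is_norm phi)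
  (phi_unitvec : forall i, phi (unitvec R i) = 1 /\ dual_norm phi (unitvec R i) = 1)
  (chi eps0 : R) (P : R -> set 'cV[R]_q) (eps : nat -> R)
  (chi_gt : expR 1 / (4 * Num.sqrt 2) < chi)
  (eps0_gt0 : 0 < eps0)
  (P_barvinok : forall e : R, 0 < e < eps0 -> barvinok_polytope phi chi e (P e))
  (eps_bounds : forall k, (1 <= k)%N -> 0 < eps k < eps0)
  (eps_decr : forall k, (1 <= k)%N -> eps k.+1 < eps k)
  (eps_cvg0 : eps @ \oo --> (0 : R))
  (delta : R) (delta_bounds : 0 < delta < tau)
  (j0 : nat) (j0_ge1 : (1 <= j0)%N)
  (hausdorff_le :
    (hausdorff_dist (Sstar A M y tau phi)
       (Srelax A M y tau phi (Qpoly phi P eps j0)) <= delta%:E)%E)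
  (nhat : nat) (Gamma : 'M[R]_(q, nhat))
  (Gamma_cols : columns_enumerate Gamma (Qnormals phi P eps j0))
  (k : nat) (k_ge1 : (1 <= k)%N)
  (matrix_cond :
    [\/ coherence_property A k,
        exists2 d : R, RIP A (2 * k) d & d < 1 / Num.sqrt 2,
        exists rho : R, stable_NSP A k rho |
        [\/ exists (N : 'cV[R]_m -> R) (rho1 rho2 : R), robust_NSP A k N rho1 rho2,
            NSP A k |
            RSP A k]]) :
  let c := cconst A M in
  let gam := gammabar A M y tau Gamma in
  let r x := phi (residual A M y x) in
  (forall x : 'cV[R]_n, exists2 xs, optimal A M y tau phi xs &
     l2norm (x - xs) <=
       delta + 2 * gam * (nhat%:R * Num.max (r x - tau) 0
                          + 2 * best_kterm_error k x + c * tau + c * r x))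
  /\
  (forall x : 'cV[R]_n, feasible A M y tau phi x ->
     exists2 xs, optimal A M y tau phi xs &
       l2norm (x - xs) <=
         delta + 2 * gam * (2 * best_kterm_error k x + c * tau + c * r x)
         <= delta + 4 * gam * (best_kterm_error k x + c * tau)).
Proof.
move=> c gam r.
have n_gt0 : (0 < n)%N by apply: leq_trans m_lt_n.
have dual1 i : dual_norm phi (unitvec R i) = 1 := (phi_unitvec i).2.
have rsp := matrix_cond_weak_RSP k_ge1 matrix_cond.
case: Gamma_cols => _ colsE.
have colQ j : Qnormals phi P eps j0 (col j Gamma) by rewrite -colsE; exists j.
have Qcol a : Qnormals phi P eps j0 a -> exists j, col j Gamma = a.
  by rewrite -colsE => -[j _ <-]; exists j.
have col_le_phi j z : dotp (col j Gamma) z <= phi z.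
  exact: dotp_Qnormals_le_norm (colQ j).
have colP i : exists j, col j Gamma = unitvec R i.
  by apply: Qcol; right; exists i; left.
have colN i : exists j, col j Gamma = - unitvec R i.
  by apply: Qcol; right; exists i; right.
have c_gt0 : 0 < c := cconst_gt0 k_ge1 n_gt0 rankA rankM rsp.
have gam_gt0 : 0 < gam.
  exact: gammabar_gt0 rankA tau_gt0 phi_norm col_le_phi n_gt0.
have main x : exists2 xs, optimal A M y tau phi xs &
    l2norm (x - xs) <= delta + 2 * gam * (nhat%:R * Num.max (r x - tau) 0
                          + 2 * best_kterm_error k x + c * tau + c * r x).
  have [xr [Gxr xr_opt close]] := exists_close_relaxed_optimum
    y rankA rankM tau_gt0 phi_norm col_le_phi colP colN x n_gt0 rsp.
  have r0 : 0 <= r x := is_norm_ge0 phi_norm _.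
  (* The term [c * tau] makes the bracket positive even when the others vanish, so [gam * Xi] can
     serve as slack below. *)
  set Xi := (X in 2 * gam * X); have Xi_gt0 : 0 < Xi.
    rewrite ltr_wpDr ?mulr_ge0 ?(ltW c_gt0) // ltr_wpDl ?mulr_gt0 //.
    rewrite addr_ge0 ?mulr_ge0 ?best_kterm_error_ge0 // le_max lexx orbT //.
  (* The relaxation contains the feasible set of (P), so the l1 norm of its optimum [xr] is at most
     the optimal value of (P). *)
  have xrS : Srelax A M y tau phi (Qpoly phi P eps j0) xr.
    split.
      apply: lb_le_inf.
        have [x0 fx0] := exists_feasible M y rankA tau_gt0 phi_norm.
        by exists (l1norm x0), x0.
      move=> _ [z fz <-]; apply: xr_opt.
      exact: feasible_relaxed col_le_phi _ fz.
    apply: Qpoly_normals => a /Qcol[j <-].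
    rewrite dotpZr mulrC ler_pdivrMr // mul1r.
    by move/lev_relaxed : Gxr.
  (* The slack [gam * Xi] is as large as the bound on [l2norm (x - xr)]; the two add up to
     [2 * gam * Xi]. *)
  have [xs xsS xs_close] :=
    hausdorff_dist_close hausdorff_le (mulr_gt0 gam_gt0 Xi_gt0) xrS.
  exists xs; first exact: Sstar_optimal.
  have -> : x - xs = (x - xr) - (xs - xr) by rewrite opprB addrA subrK.
  rewrite (le_trans (ler_l2normD _ _)) // l2normN.
  move: close xs_close; rewrite -/gam -/c -/(r x) -/Xi; lra.
split=> // x fx; have [xs xs_opt xs_close] := main x; exists xs => //.
have r_max : Num.max (r x - tau) 0 = 0.
  by apply/max_idPr; rewrite subr_le0.
rewrite r_max mulr0 add0r in xs_close; rewrite xs_close /=.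
have -> : 4 * gam * (best_kterm_error k x + c * tau) =
  2 * gam * (2 * best_kterm_error k x + c * tau + c * tau) by ring.
by rewrite lerD2l ler_pM2l ?mulr_gt0 // lerD2l ler_pM2l.
Qed.
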